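(* Let $1\le p\le 2$, $\varsigma\in L^1(\mathbb{Z}^n\times\mathbb{T}^n)$, $g_1\in\ell^2(\mathbb{Z}^n)$ and $g_2\in M^p(\mathbb{Z}^n)$. Then the localization operator $\mathfrak{L}^{g_1,g_2}_\varsigma$ is in $\mathcal{B}(M^p(\mathbb{Z}^n))$, and $$\|\mathfrak{L}^{g_1,g_2}_\varsigma\|_{\mathcal{B}(M^p(\mathbb{Z}^n))}\le\|\varsigma\|_{L^1(\mathbb{Z}^n\times\mathbb{T}^n)}\,\|g_1\|_{\ell^2(\mathbb{Z}^n)}\,\|g_2\|_{M^p(\mathbb{Z}^n)}.$$
   Context: $\mathbb{T}^n$ is the torus with normalized Haar measure $dw$; $\mathbb{Z}^n\times\mathbb{T}^n$ carries the product of counting measure and $dw$. $T_mf(k)=f(k-m)$, $M_wf(k)=e^{2\pi i w\cdot k}f(k)$, and the short-time Fourier transform is $V_gf(m,w)=\langle f,M_wT_mg\rangle=\sum_{k\in\mathbb{Z}^n}f(k)\overline{g(k-m)}e^{-2\pi i w\cdot k}$ (the pairing $\langle\cdot,\cdot\rangle$ being the sesquilinear duality extending the $\ell^2(\mathbb{Z}^n)$ inner product, in particular that between $M^p(\mathbb{Z}^n)$ and $M^{p'}(\mathbb{Z}^n)$, $p'$ the conjugate exponent). $\mathcal{S}(\mathbb{Z}^n)$ is the space of rapidly decreasing functions on $\mathbb{Z}^n$ and $\mathcal{S}'(\mathbb{Z}^n)$ its dual (tempered distributions). Modulation space: fix a non-zero window $g\in\mathcal{S}(\mathbb{Z}^n)$;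 for $1\le p\le\infty$, $M^p(\mathbb{Z}^n)=\{f\in\mathcal{S}'(\mathbb{Z}^n): V_gf\in L^p(\mathbb{Z}^n\times\mathbb{T}^n)\}$ with $\|f\|_{M^p(\mathbb{Z}^n)}=\|V_gf\|_{L^p(\mathbb{Z}^n\times\mathbb{T}^n)}$ (different windows give equivalent norms). Localization operator: $\mathfrak{L}^{g_1,g_2}_\varsigma f(k)=\sum_{m\in\mathbb{Z}^n}\int_{\mathbb{T}^n}\varsigma(m,w)V_{g_1}f(m,w)\,M_wT_mg_2(k)\,dw$, or in the weak sense $$\langle\mathfrak{L}^{g_1,g_2}_\varsigma f,h\rangle=\sum_{m\in\mathbb{Z}^n}\int_{\mathbb{T}^n}\varsigma(m,w)\,V_{g_1}f(m,w)\,\overline{V_{g_2}h(m,w)}\,dw,\qquad f\in M^p(\mathbb{Z}^n),\ h\in M^{p'}(\mathbb{Z}^n).$$ $\mathcal{B}(X)$ denotes the bounded linear operators on $X$ with operator norm.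
   Formalization: The norm inequality is proved only for windows g defining the M^p norm with ℓ² norm at least 1 (it fails for windows of ℓ² norm below 1, e.g. p = 2, g₁ = g₂ = δ₀, ς = 1 on {0}×Tⁿ); membership in B(M^p) is proved for every non-zero window. *)

(* Defs.v *)
From HB Require Import structures.
From mathcomp Require Import all_boot all_order all_algebra.
From mathcomp Require Import all_classical all_reals all_analysis.
From mathcomp Require Import complex.
Set Implicit Arguments.
Unset Strict Implicit.
Unset Printing Implicit Defensive.
Import Order.TTheory GRing.Theory Num.Theory.
Import numFieldNormedType.Exports.
Local Open Scope classical_set_scope.
Local Open Scope ring_scope.
Local Open Scope complex_scope.

Definition cabs (R : realType) (z : R[i]) : R := complex.Re `|z|.

(* The character value e^{2 pi i t}. *)
Definition cis (R : realType) (t : R) : R[i] :=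
  cos (2 * pi * t) +i* sin (2 * pi * t).

(* Z^n, with the discrete sigma-algebra. *)
Definition lattice (n : nat) : Type := 'rV[int]_n.
HB.instance Definition _ n := Choice.on (lattice n).
HB.instance Definition _ n := GRing.Zmodule.on (lattice n).
HB.instance Definition _ n := isPointed.Build (lattice n) 0.
HB.instance Definition _ n :=
  @isMeasurable.Build default_measure_display (lattice n) discrete_measurable
    discrete_measurable0 discrete_measurableC discrete_measurableU.

Definition lattice_norm (R : realType) (n : nat) (k : lattice n) : R :=
  Num.sqrt (\sum_(i < n) (k 0 i)%:~R ^+ 2).

(* T^n = R^n/Z^n is represented by its fundamental domain [0, 1)^n: its points
   are tuples of reals, and its Haar measure [haar] below is carried by
   [0, 1)^n, so that values of functions outside [0, 1)^n are irrelevant. *)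
Definition torus (R : realType) (n : nat) : Type :=
  n.-tuple (measurableTypeR R).
HB.instance Definition _ R n := Measurable.on (torus R n).

Section haar.
Variable R : realType.

Definition haar1 : set (measurableTypeR R) -> \bar R :=
  mrestr lebesgue_measure (measurable_itv `[0%R, 1%R[).

HB.instance Definition _ := Measure.on haar1.

Lemma haar1_setT : haar1 setT = 1%E.
Proof.
by rewrite /haar1 /mrestr/= setTI lebesgue_measure_itv/= lte01 oppr0 adde0.
Qed.

HB.instance Definition _ :=
  Measure_isProbability.Build _ _ _ haar1 haar1_setT.

Definition torus_cons (n : nat) (x : measurableTypeR R * torus R n) :
  torus R n.+1 := cons_tuple x.1 x.2.

Lemma measurable_torus_cons n : measurable_fun setT (@torus_cons n).
Proof.
exact: (measurable_cons (f := fst) (g := snd)).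
Qed.

HB.instance Definition _ n :=
  isMeasurableFun.Build _ _ _ _ (@torus_cons n) (@measurable_torus_cons n).

Fixpoint haar (n : nat) : probability (torus R n) R :=
  match n return probability (torus R n) R with
  | 0 => \d_([tuple] : torus R 0)
  | n'.+1 => distribution (haar1 \x haar n')%E (@torus_cons n')
  end.

End haar.

Section complex_integration.
Context d (T : measurableType d) (R : realType).
Variable mu : {measure set T -> \bar R}.

Definition cintegral (F : T -> R[i]) : R[i] :=
  (\int[mu]_x complex.Re (F x)) +i* (\int[mu]_x complex.Im (F x)).

Definition cLnorm (p : \bar R) (F : T -> R[i]) : \bar R :=
  Lnorm mu p (fun x => (cabs (F x))%:E).

Definition in_Lp (p : \bar R) (F : T -> R[i]) : Prop :=
  [/\ measurable_fun setT (fun x => complex.Re (F x)),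
      measurable_fun setT (fun x => complex.Im (F x)) &
      (cLnorm p F < +oo)%E].

End complex_integration.

Section time_frequency.
Variables (R : realType) (n : nat).
Implicit Types (f g h phi psi : lattice n -> R[i]) (k m : lattice n)
  (w : torus R n) (p : \bar R).

Definition count_measure : {measure set (lattice n) -> \bar R} := counting.

Definition tf_measure : {measure set (lattice n * torus R n) -> \bar R} :=
  (count_measure \x haar R n)%E.

Definition ell_norm p f : \bar R := cLnorm count_measure p f.
Definition in_ell p f : Prop := in_Lp count_measure p f.

Definition dot w k : R := \sum_(i < n) tnth w i * (k 0 i)%:~R.
Definition transl m f : lattice n -> R[i] := fun k => f (k - m).
Definition modul w f : lattice n -> R[i] := fun k => cis (dot w k) * f k.

Definition pairing f h : R[i] := cintegral count_measure (fun k => f k * (h k)^*).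

Definition stft g f (z : lattice n * torus R n) : R[i] :=
  pairing f (modul z.2 (transl z.1 g)).

Definition schwartz phi : Prop :=
  forall N : nat, exists C : R, forall k,
    (1 + lattice_norm R k) ^+ N * cabs (phi k) <= C.

Definition schwartz_seminorm (N : nat) phi : R :=
  sup (range (fun k => (1 + lattice_norm R k) ^+ N * cabs (phi k))).

Definition schwartz_dual (u : (lattice n -> R[i]) -> R[i]) : Prop :=
  (forall (a : R[i]) phi psi, schwartz phi -> schwartz psi ->
     u (fun k => a * phi k + psi k) = a * u phi + u psi) /\
  (exists (N : nat) (C : R), forall phi, schwartz phi ->
     cabs (u phi) <= C * schwartz_seminorm N phi).

Definition delta m : lattice n -> R[i] := fun k => (k == m)%:R.

(* A tempered distribution u is identified with the function k |-> u (delta k)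
   on Z^n; this determines u because the finitely supported functions are dense
   in the Schwartz space. *)
Definition tempered f : Prop :=
  exists u, schwartz_dual u /\ forall k, u (delta k) = f k.

Definition modulation_norm g p f : \bar R := cLnorm tf_measure p (stft g f).

Definition modulation_space g p f : Prop :=
  tempered f /\ in_Lp tf_measure p (stft g f).

(* T belongs to B(M^p), M^p being taken with respect to the window g. *)
Definition bounded_on_modulation g p
    (T : (lattice n -> R[i]) -> lattice n -> R[i]) : Prop :=
  [/\ forall f, modulation_space g p f -> modulation_space g p (T f),
      forall (a : R[i]) f h,
        modulation_space g p f -> modulation_space g p h ->
        T (fun k => a * f k + h k) = (fun k => a * T f k + T h k) &
      exists C : R, forall f, modulation_space g p f ->
        (modulation_norm g p (T f) <= C%:E * modulation_norm g p f)%E].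

Definition modulation_opnorm g p
    (T : (lattice n -> R[i]) -> lattice n -> R[i]) : \bar R :=
  ereal_sup [set modulation_norm g p (T f) | f in
    [set f | modulation_space g p f /\ (modulation_norm g p f <= 1)%E]].

Definition localization (s : lattice n * torus R n -> R[i]) g1 g2 f :
    lattice n -> R[i] := fun k =>
  cintegral count_measure (fun m => cintegral (haar R n) (fun w =>
    s (m, w) * stft g1 f (m, w) * modul w (transl m g2) k)).

(* [cintegral] is a total function, with an arbitrary value on non-integrable
   functions; this says that all the sums and integrals in [localization] at f
   are absolutely convergent. *)
Definition localization_converges (s : lattice n * torus R n -> R[i])
    g1 g2 f : Prop :=
  (forall m w, in_ell 1%E (fun k => f k * (modul w (transl m g1) k)^*)) /\
  (forall k, in_Lp tf_measure 1%E (fun z =>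
    s z * stft g1 f z * modul z.2 (transl z.1 g2) k)).

End time_frequency.

(* Main.v *)
From HB Require Import structures.
Require Import Defs.
From mathcomp Require Import all_boot all_order all_algebra.
From mathcomp Require Import all_classical all_reals all_analysis.
From mathcomp Require Import measurable_realfun complex.
From mathcomp Require Import ring lra zify.
Set Implicit Arguments.
Unset Strict Implicit.
Unset Printing Implicit Defensive.
Import Order.TTheory GRing.Theory Num.Theory.
Import numFieldNormedType.Exports.
Local Open Scope complex_scope.
Local Open Scope ring_scope.

(** Write [pi(z) h] for the time-frequency shift [M_w T_m h], [z = (m, w)], and
    [V_g] for the short-time Fourier transform with window [g].

    The localization operator is a superposition of time-frequency shifts of
    its synthesis window: [L f] is the integral of [W(z) pi(z) g2] with the
    weight [W = s * V_g1 f]. Up to a phase, [V_g (pi(z) g2)] is the translate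
    of [V_g g2] by [z] ([cabs_stft_shift]), so [|V_g (L f)|] is dominated by
    the convolution of [|W|] with [|V_g g2|]. Young's inequality
    ([Lp_superposition], from Jensen's inequality and Tonelli's theorem)
    together with the translation invariance of the measure
    ([haar_translation], [integral_tf_translation]) bounds the modulation norm
    of [L f] by the [L^1] norm of [W] times the modulation norm of [g2]; this
    is [modulation_norm_synthesis]. By the Cauchy-Schwarz inequality
    [|V_g1 f|] is at most the product of the [l^2] norms of [f] and [g1], so
    it remains to compare the [l^2] norm of [f] with its modulation norm.

    That comparison, [ell2_le_modulation_norm], is where [p <= 2] enters. For
    fixed [m], [V_g f (m, .)] is the Fourier series of
    [k |-> f k * conj (g (k - m))], an absolutely summable sequence because
    [f] grows at most polynomially and [g] is rapidly decreasing. Its Fourier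
    coefficients are bounded by its [L^p] norm on the torus, a probability
    space; choosing a point where [g] does not vanish and summing over [m]
    gives [f] in [l^p], hence in [l^2] ([modulation_ellp],
    [modulation_ell2]). Once [f] is known to be in [l^2], Parseval's identity
    yields Moyal's identity: the [L^2] norm of [V_g f] equals
    [A = |f|_2 * |g|_2] ([integral_sqr_stft]). As [|V_g f| <= A] pointwise,
    [A ^ 2 <= A ^ (2 - p) * (|V_g f|_p) ^ p], that is [A <= |V_g f|_p]. With
    [1 <= |g|_2] this is the inequality needed, with constant 1; without it
    the operator is still bounded, with an extra factor [1 / |g|_2].

    The orthogonality of the characters behind Parseval's identity is also
    deduced from translation invariance ([integral_character]). *)

(** * Complex modulus and complex measurability *)

Section complex_modulus.
Variable R : realType.
Implicit Types z u : R[i].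

Lemma cabsE z : cabs z = Num.sqrt (complex.Re z ^+ 2 + complex.Im z ^+ 2).
Proof. by rewrite /cabs normc_def. Qed.

Lemma cabs_ge0 z : 0 <= cabs z.
Proof. by rewrite cabsE sqrtr_ge0. Qed.

Lemma cabs_real z : `|z| = (cabs z)%:C.
Proof. by rewrite cabsE normc_def. Qed.

Lemma cabsM z u : cabs (z * u) = cabs z * cabs u.
Proof. by apply: complexI; rewrite rmorphM/= -!cabs_real normrM. Qed.

Lemma cabs_conj z : cabs z^* = cabs z.
Proof. by case: z => a b; rewrite !cabsE /conj/= sqrrN. Qed.

Lemma cabsD z u : cabs (z + u) <= cabs z + cabs u.
Proof. by rewrite -lecR rmorphD/= -!cabs_real ler_normD. Qed.

Lemma cabs_eq0 z : (cabs z == 0) = (z == 0).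
Proof. by rewrite -[RHS]normr_eq0 cabs_real eq_complex/= eqxx andbT. Qed.

Lemma cabs0 : cabs (0 : R[i]) = 0.
Proof. by apply/eqP; rewrite cabs_eq0. Qed.

Lemma cabs1 : cabs (1 : R[i]) = 1.
Proof. by rewrite cabsE/= expr1n expr0n addr0 sqrtr1. Qed.

Lemma cabs_Re z : `|complex.Re z| <= cabs z.
Proof.
by rewrite cabsE -sqrtr_sqr ler_wsqrtr// lerDl sqr_ge0.
Qed.

Lemma cabs_Im z : `|complex.Im z| <= cabs z.
Proof.
by rewrite cabsE -sqrtr_sqr ler_wsqrtr// lerDr sqr_ge0.
Qed.

Lemma cabs_cis (t : R) : cabs (cis t) = 1.
Proof. by rewrite cabsE/= cos2Dsin2 sqrtr1. Qed.

Lemma cisD (t u : R) : cis (t + u) = cis t * cis u.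
Proof.
rewrite /cis mulrDr cosD sinD; apply/eqP; rewrite eq_complex/=.
by rewrite eqxx/=; apply/eqP; ring.
Qed.

Lemma cisN (t : R) : cis (- t) = (cis t)^*.
Proof. by rewrite /cis mulrN cosN sinN. Qed.

Lemma cis0 : cis 0 = 1 :> R[i].
Proof. by rewrite /cis mulr0 cos0 sin0. Qed.

Lemma conjCM z u : (z * u)^* = z^* * u^*.
Proof. exact: rmorphM. Qed.

Lemma mul_conj z : z * z^* = (cabs z ^+ 2)%:C.
Proof. by rewrite -sqr_normc cabs_real -rmorphXn. Qed.

Lemma sqr_cabs z : cabs z ^+ 2 = complex.Re (z * z^*).
Proof. by rewrite mul_conj. Qed.

End complex_modulus.

Section complex_measurability.
Context d (T : measurableType d) (R : realType).
Implicit Types F G : T -> R[i].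

Definition cmeasurable F :=
  measurable_fun setT (fun x => complex.Re (F x)) /\
  measurable_fun setT (fun x => complex.Im (F x)).

Lemma cmeasurable_cst (z : R[i]) : cmeasurable (fun=> z).
Proof. by split; exact: measurable_cst. Qed.

Lemma cmeasurableM F G : cmeasurable F -> cmeasurable G ->
  cmeasurable (fun x => F x * G x).
Proof.
move=> [Fr Fi] [Gr Gi]; split.
  rewrite [X in measurable_fun _ X](_ : _ =
    (fun x => complex.Re (F x) * complex.Re (G x)) \-
    (fun x => complex.Im (F x) * complex.Im (G x))).
    by apply: measurable_funB; exact: measurable_funM.
  by apply/funext => x /=; case: (F x) (G x) => [a b] [c e].
rewrite [X in measurable_fun _ X](_ : _ =
    (fun x => complex.Re (F x) * complex.Im (G x)) \+
    (fun x => complex.Im (F x) * complex.Re (G x))).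
  by apply: measurable_funD; exact: measurable_funM.
by apply/funext => x /=; case: (F x) (G x) => [a b] [c e].
Qed.

Lemma cmeasurableD F G : cmeasurable F -> cmeasurable G ->
  cmeasurable (fun x => F x + G x).
Proof.
move=> [Fr Fi] [Gr Gi]; split.
  rewrite [X in measurable_fun _ X](_ : _ =
    (fun x => complex.Re (F x)) \+ (fun x => complex.Re (G x))).
    exact: measurable_funD.
  by apply/funext => x /=; case: (F x) (G x) => [a b] [c e].
rewrite [X in measurable_fun _ X](_ : _ =
    (fun x => complex.Im (F x)) \+ (fun x => complex.Im (G x))).
  exact: measurable_funD.
by apply/funext => x /=; case: (F x) (G x) => [a b] [c e].
Qed.

Lemma cmeasurable_conj F : cmeasurable F -> cmeasurable (fun x => (F x)^*).
Proof.
move=> [Fr Fi]; split.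
  rewrite [X in measurable_fun _ X](_ : _ = fun x => complex.Re (F x))//.
  by apply/funext => x; case: (F x).
rewrite [X in measurable_fun _ X](_ : _ = \- (fun x => complex.Im (F x))).
  exact: measurableT_comp.
by apply/funext => x /=; case: (F x).
Qed.

Lemma cmeasurable_cabs F : cmeasurable F ->
  measurable_fun setT (fun x => cabs (F x)).
Proof.
move=> [Fr Fi].
rewrite [X in measurable_fun _ X](_ : _ = (@Num.sqrt R) \o
  ((fun x => complex.Re (F x) ^+ 2) \+ (fun x => complex.Im (F x) ^+ 2))).
  apply: measurableT_comp.
    by apply: continuous_measurable_fun; exact: sqrt_continuous.
  by apply: measurable_funD; exact: measurable_funX.
by apply/funext => x; rewrite /= cabsE.
Qed.

End complex_measurability.

(** * Integrals of complex functions *)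

Section complex_integral.
Context d (T : measurableType d) (R : realType).
Variable mu : {measure set T -> \bar R}.
Implicit Types F G : T -> R[i].
Local Open Scope ereal_scope.

Definition cintegrable F :=
  cmeasurable F /\ \int[mu]_x (cabs (F x))%:E < +oo.

Lemma cLnormE (p : R) F :
  cLnorm mu p%:E F = (\int[mu]_x ((cabs (F x)) `^ p)%:E) `^ p^-1.
Proof.
rewrite /cLnorm unlock; congr (_ `^ _); apply: eq_integral => x _.
by rewrite gee0_abs ?lee_fin ?cabs_ge0// poweR_EFin.
Qed.

Lemma cLnorm1 F : cLnorm mu 1 F = \int[mu]_x (cabs (F x))%:E.
Proof.
rewrite /cLnorm Lnorm1; apply: eq_integral => x _.
by rewrite gee0_abs ?lee_fin ?cabs_ge0.
Qed.

Lemma in_Lp1P F : in_Lp mu 1 F <-> cintegrable F.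
Proof.
by rewrite /in_Lp cLnorm1; split=> [[]|[[]]].
Qed.

Lemma ge0_le_integralT (h1 h2 : T -> \bar R) :
  (forall x, 0 <= h1 x) -> measurable_fun setT h1 -> measurable_fun setT h2 ->
  (forall x, h1 x <= h2 x) -> \int[mu]_x h1 x <= \int[mu]_x h2 x.
Proof. by move=> h0 m1 m2 h12; apply: ge0_le_integral. Qed.

Lemma measurable_cabs_EFin F : cmeasurable F ->
  measurable_fun setT (fun x => (cabs (F x))%:E).
Proof. by move=> mF; apply/measurable_EFinP; exact: cmeasurable_cabs. Qed.

Lemma le_cintegrable F (h : T -> R) : cmeasurable F -> measurable_fun setT h ->
  (forall x, (cabs (F x) <= h x)%R) -> \int[mu]_x (h x)%:E < +oo ->
  cintegrable F.
Proof.
move=> mF mh Fh hoo; split=> //; apply: le_lt_trans hoo.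
apply: ge0_le_integralT => [x|||x]; rewrite ?lee_fin ?cabs_ge0//.
- exact: measurable_cabs_EFin.
- exact/measurable_EFinP.
Qed.

Lemma cintegrable_Re F : cintegrable F ->
  mu.-integrable setT (EFin \o (fun x => complex.Re (F x))).
Proof.
move=> [mF Foo]; apply/integrableP; split; first exact/measurable_EFinP/mF.1.
apply: le_lt_trans Foo; apply: ge0_le_integralT => //.
- by apply: measurableT_comp => //; exact/measurable_EFinP/mF.1.
- exact: measurable_cabs_EFin.
- by move=> x; rewrite /= lee_fin cabs_Re.
Qed.

Lemma cintegrable_Im F : cintegrable F ->
  mu.-integrable setT (EFin \o (fun x => complex.Im (F x))).
Proof.
move=> [mF Foo]; apply/integrableP; split; first exact/measurable_EFinP/mF.2.
apply: le_lt_trans Foo; apply: ge0_le_integralT => //.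
- by apply: measurableT_comp => //; exact/measurable_EFinP/mF.2.
- exact: measurable_cabs_EFin.
- by move=> x; rewrite /= lee_fin cabs_Im.
Qed.

Lemma cintegrableZl (z : R[i]) F : cintegrable F ->
  cintegrable (fun x => z * F x)%R.
Proof.
move=> [mF Foo]; split; first by apply: cmeasurableM => //; exact: cmeasurable_cst.
under eq_integral do rewrite cabsM EFinM.
rewrite ge0_integralZl ?lee_fin ?cabs_ge0//.
- by rewrite lte_mul_pinfty ?lee_fin ?cabs_ge0// integral_ge0// => x _; rewrite lee_fin cabs_ge0.
- exact: measurable_cabs_EFin.
- by move=> x _; rewrite lee_fin cabs_ge0.
Qed.

Lemma cintegrableD F G : cintegrable F -> cintegrable G ->
  cintegrable (fun x => F x + G x)%R.
Proof.
move=> [mF Foo] [mG Goo].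
apply: (@le_cintegrable _ (fun x => cabs (F x) + cabs (G x))%R).
- exact: cmeasurableD.
- by apply: measurable_funD; exact: cmeasurable_cabs.
- by move=> x; exact: cabsD.
- under eq_integral do rewrite EFinD.
  rewrite ge0_integralD//; first exact: lte_add_pinfty.
  + by move=> x _; rewrite lee_fin cabs_ge0.
  + exact: measurable_cabs_EFin.
  + by move=> x _; rewrite lee_fin cabs_ge0.
  + exact: measurable_cabs_EFin.
Qed.

Lemma cintegrable_conj F : cintegrable F -> cintegrable (fun x => (F x)^*).
Proof.
move=> [mF Foo]; split; first exact: cmeasurable_conj.
by under eq_integral do rewrite cabs_conj.
Qed.

Lemma integrableZl_EFin (k : R) (f : T -> R) :
  mu.-integrable setT (EFin \o f) ->
  mu.-integrable setT (EFin \o (fun x => k * f x)%R).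
Proof.
by move=> /(integrableZl measurableT k); apply: eq_integrable.
Qed.

Lemma cintegralZl (z : R[i]) F : cintegrable F ->
  cintegral mu (fun x => z * F x)%R = (z * cintegral mu F)%R.
Proof.
move=> iF; have iR := cintegrable_Re iF; have iI := cintegrable_Im iF.
case: z => a b; rewrite /cintegral; apply/eqP; rewrite eq_complex /=.
apply/andP; split; apply/eqP.
  rewrite -RintegralZl// -[in RHS]RintegralZl// -RintegralB//.
  - by apply: eq_Rintegral => x _; case: (F x).
  - exact: integrableZl_EFin.
  - exact: integrableZl_EFin.
rewrite -RintegralZl// -[in RHS]RintegralZl// -RintegralD//.
- by apply: eq_Rintegral => x _; case: (F x).
- exact: integrableZl_EFin.
- exact: integrableZl_EFin.
Qed.

Lemma cintegralD F G : cintegrable F -> cintegrable G ->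
  cintegral mu (fun x => F x + G x)%R = (cintegral mu F + cintegral mu G)%R.
Proof.
move=> iF iG; rewrite /cintegral; apply/eqP; rewrite eq_complex /=.
apply/andP; split; apply/eqP.
  rewrite -RintegralD//; [|exact: cintegrable_Re|exact: cintegrable_Re].
  by apply: eq_Rintegral => x _; case: (F x) (G x) => [a b] [c e].
rewrite -RintegralD//; [|exact: cintegrable_Im|exact: cintegrable_Im].
by apply: eq_Rintegral => x _; case: (F x) (G x) => [a b] [c e].
Qed.

Lemma cintegral_conj F : cintegrable F ->
  cintegral mu (fun x => (F x)^*) = (cintegral mu F)^*.
Proof.
move=> iF; rewrite /cintegral /=; congr (_ +i* _).
  by apply: eq_Rintegral => x _; case: (F x).
rewrite -mulN1r -RintegralZl//; last exact: cintegrable_Im.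
by apply: eq_Rintegral => x _; case: (F x) => a b /=; rewrite mulN1r.
Qed.

Lemma eq_cintegral F G : F =1 G -> cintegral mu F = cintegral mu G.
Proof. by move=> FG; congr cintegral; exact/funext. Qed.

(** Rotating [F] so that its integral becomes a nonnegative real reduces the
    triangle inequality to the real part. *)
Lemma cabs_cintegral_le F : cintegrable F ->
  (cabs (cintegral mu F))%:E <= \int[mu]_x (cabs (F x))%:E.
Proof.
move=> iF; set I := cintegral mu F.
have [I0|I0] := eqVneq I 0%R.
  rewrite I0 cabs0; apply: integral_ge0 => x _.
  by rewrite lee_fin cabs_ge0.
have cI0 : cabs I != 0%R by rewrite cabs_eq0.
(* the phase that rotates [I] onto the positive real axis *)
pose u : R[i] := ((cabs I)^-1%:C * I^*)%R.
have cu : cabs u = 1%R.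
  rewrite /u cabsM cabs_conj [X in (X * _)%R](_ : _ = (cabs I)^-1%R) ?mulVf//.
  by rewrite cabsE/= expr0n addr0 sqrtr_sqr ger0_norm// invr_ge0 cabs_ge0.
have uI : (u * I)%R = (cabs I)%:C.
  by rewrite /u -mulrA [(_^* * _)%R]mulrC mul_conj -rmorphM expr2 mulKf.
have -> : cabs I = complex.Re (cintegral mu (fun x => u * F x)%R).
  by rewrite cintegralZl// -/I uI.
have iuF : cintegrable (fun x => u * F x)%R by exact: cintegrableZl.
have iR := cintegrable_Re iuF.
rewrite /= /Rintegral fineK; last exact: integrable_fin_num.
apply: le_integral => //; first last.
- move=> x _; rewrite lee_fin (le_trans (ler_norm _))// (le_trans (cabs_Re _))//.
  by rewrite cabsM cu mul1r.
- apply/integrableP; split; first exact: measurable_cabs_EFin iF.1.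
  by under eq_integral do rewrite gee0_abs ?lee_fin ?cabs_ge0//; exact: iF.2.
Qed.

End complex_integral.

Section complex_fubini.
Context d1 d2 (T1 : measurableType d1) (T2 : measurableType d2) (R : realType).
Variable m1 : {sigma_finite_measure set T1 -> \bar R}.
Variable m2 : {sigma_finite_measure set T2 -> \bar R}.
Implicit Types (f : T1 * T2 -> R) (F : T1 * T2 -> R[i]).
Local Open Scope ereal_scope.

(** The inner integral is finite only almost everywhere, so that taking its
    finite part changes the outer integrand on a negligible set. *)
Lemma Rintegral12_prod f : (m1 \x m2).-integrable setT (EFin \o f) ->
  (\int[m1]_x \int[m2]_y f (x, y))%R = (\int[m1 \x m2]_z f z)%R.
Proof.
move=> fi; rewrite /Rintegral -(integral12_prod_meas1 fi)//; congr fine.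
apply: ae_eq_integral => //.
- apply/measurable_EFinP; apply: measurableT_comp => //.
  exact: (measurable_fubini_F fi).
- exact: (measurable_fubini_F fi).
- apply: filterS (ae_integrable1 fi) => x ix _ /=.
  by rewrite fineK//; exact: integrable_fin_num ix.
Qed.

Lemma Rintegral21_prod f : (m1 \x m2).-integrable setT (EFin \o f) ->
  (\int[m2]_y \int[m1]_x f (x, y))%R = (\int[m1 \x m2]_z f z)%R.
Proof.
move=> fi; rewrite /Rintegral -(integral21_prod_meas1 fi)//; congr fine.
apply: ae_eq_integral => //.
- apply/measurable_EFinP; apply: measurableT_comp => //.
  exact: (measurable_fubini_G fi).
- exact: (measurable_fubini_G fi).
- apply: filterS (ae_integrable2 fi) => x ix _ /=.
  by rewrite fineK//; exact: integrable_fin_num ix.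
Qed.

Lemma cintegral12_prod F : cintegrable (m1 \x m2) F ->
  cintegral m1 (fun x => cintegral m2 (fun y => F (x, y))) =
  cintegral (m1 \x m2) F.
Proof.
move=> iF; rewrite /cintegral /=; congr (_ +i* _).
  exact: (Rintegral12_prod (cintegrable_Re iF)).
exact: (Rintegral12_prod (cintegrable_Im iF)).
Qed.

Lemma cintegral21_prod F : cintegrable (m1 \x m2) F ->
  cintegral m2 (fun y => cintegral m1 (fun x => F (x, y))) =
  cintegral (m1 \x m2) F.
Proof.
move=> iF; rewrite /cintegral /=; congr (_ +i* _).
  exact: (Rintegral21_prod (cintegrable_Re iF)).
exact: (Rintegral21_prod (cintegrable_Im iF)).
Qed.

(** Where the inner integral diverges its conventional value is used; the
    resulting function is measurable all the same. *)
Lemma cmeasurable_cintegral1 F : cintegrable (m1 \x m2) F ->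
  cmeasurable (fun y => cintegral m1 (fun x => F (x, y))).
Proof.
move=> iF; split.
  apply: measurableT_comp; first exact: fine_measurable.
  exact: (measurable_fubini_G (cintegrable_Re iF)).
apply: measurableT_comp; first exact: fine_measurable.
exact: (measurable_fubini_G (cintegrable_Im iF)).
Qed.

Lemma cintegrable_prod F : cmeasurable F ->
  \int[m1]_x \int[m2]_y (cabs (F (x, y)))%:E < +oo ->
  cintegrable (m1 \x m2) F.
Proof.
move=> mF Foo; split=> //.
rewrite (fubini_tonelli1 (fun z => (cabs (F z))%:E))//.
- exact: measurable_cabs_EFin.
- by move=> x; rewrite lee_fin cabs_ge0.
Qed.

End complex_fubini.

(** * Counting measure on the lattice *)

Section lattice_counting.
Variables (R : realType) (n : nat).
Implicit Types (k m : lattice n) (h : lattice n -> R).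
Local Open Scope classical_set_scope.
Local Open Scope ereal_scope.
Local Notation count := (count_measure R n).

Lemma lattice_countable : countable [set: lattice n].
Proof. exact: (@countableP ('rV[int]_n : countType)). Qed.

Lemma measurable_lattice (A : set (lattice n)) : measurable A.
Proof. by []. Qed.

Lemma measurable_fun_lattice d (U : measurableType d) (f : lattice n -> U) :
  measurable_fun setT f.
Proof. by move=> _ Y mY; exact: measurable_lattice. Qed.

(** The lattice is countable and discrete, so measurability on a product with
    it can be checked slice by slice. *)
Lemma measurable_fun_lattice_prod d d' (T : measurableType d)
    (U : measurableType d') (f : lattice n * T -> U) :
  (forall m, measurable_fun setT (fun x => f (m, x))) -> measurable_fun setT f.
Proof.
move=> mf _ Y mY; rewrite setTI.
have -> : f @^-1` Y =
    \bigcup_m ([set m] `*` ((fun x => f (m, x)) @^-1` Y)).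
  apply/seteqP; split=> [[m x] fY|[m x] [m' _ [/= -> //]]].
  by exists m.
apply: countable_bigcupT_measurable; first exact: lattice_countable.
move=> m; apply: measurableX; first exact: measurable_lattice.
by rewrite -[X in measurable X]setTI; exact: mf.
Qed.

Lemma cmeasurable_lattice (F : lattice n -> R[i]) : cmeasurable F.
Proof. by split; exact: measurable_fun_lattice. Qed.

Lemma cmeasurable_lattice_prod d (T : measurableType d)
    (F : lattice n * T -> R[i]) :
  (forall m, cmeasurable (fun x => F (m, x))) -> cmeasurable F.
Proof.
by move=> mF; split; apply: measurable_fun_lattice_prod => m; case: (mF m).
Qed.

Lemma sigma_finite_count : sigma_finite [set: lattice n] count.
Proof.
pose code (k : lattice n) := pickle (k : 'rV[int]_n).
exists (fun i => code @^-1` `I_i).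
  by apply/seteqP; split=> // k _; exists (code k).+1 => /=.
move=> i; split; first exact: measurable_lattice.
rewrite /= /counting asboolT ?ltry//.
apply: (@finite_preimage _ _ `I_i code) => //.
by move=> x y _ _; apply: (pcan_inj pickleK).
Qed.

(** The counting measure under a name that carries its sigma-finiteness, so
    that Fubini's theorem applies to it. *)
Definition count_sigma_finite_fun : set (lattice n) -> \bar R := counting.
HB.instance Definition _ := Measure.copy count_sigma_finite_fun count.
HB.instance Definition _ := Measure_isSigmaFinite.Build _ _ _ count_sigma_finite_fun
  sigma_finite_count.
Definition count_sigma_finite :
  {sigma_finite_measure set (lattice n) -> \bar R} := count_sigma_finite_fun.

Lemma count1 k : count [set k] = 1.
Proof. by rewrite /= /counting asboolT// fset_set1 finmap.cardfs1. Qed.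

Lemma count_bij (f : lattice n -> lattice n) (A : set (lattice n)) :
  bijective f -> count (f @^-1` A) = count A.
Proof.
move=> [g fK gK]; rewrite /= /counting.
have AE : A = f @` (f @^-1` A).
  apply/seteqP; split=> [x Ax|_ [x Ax <-]//].
  by exists (g x); rewrite /= gK.
have [fA|nfA] := pselect (finite_set A); last first.
  rewrite !asboolF//; apply: contra_not nfA => fA.
  by rewrite AE; exact: finite_image.
have fA' : finite_set (f @^-1` A).
  by apply: finite_preimage => // x y _ _; exact: (can_inj fK).
rewrite !asboolT// [in RHS]AE fset_set_image// finmap.card_imfset//.
exact: can_inj fK.
Qed.

Lemma integral_count_bij (f : lattice n -> lattice n) (h : lattice n -> \bar R) :
  bijective f -> (forall k, 0 <= h k) ->
  \int[count]_k h (f k) = \int[count]_k h k.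
Proof.
move=> bf h0; have mf := measurable_fun_lattice f.
transitivity (\int[pushforward count f]_k h k).
  by rewrite ge0_integral_pushforward//; exact: measurable_fun_lattice.
by apply: eq_measure_integral => A _ _; exact: count_bij.
Qed.

Lemma cintegral_count_bij (f : lattice n -> lattice n) (F : lattice n -> R[i]) :
  bijective f -> cintegrable count F ->
  cintegral count (fun k => F (f k)) = cintegral count F.
Proof.
move=> bf iF; have mf := measurable_fun_lattice f.
have Rbij (h : lattice n -> R) : count.-integrable setT (EFin \o h) ->
    (\int[count]_k h (f k) = \int[count]_k h k)%R.
  move=> ih; congr fine.
  transitivity (\int[pushforward count f]_k (h k)%:E).
    rewrite integral_pushforward//.
    apply/integrableP; split; first exact: measurable_fun_lattice.
    rewrite preimage_setT (integral_count_bij (h := fun k => `|(h k)%:E|))//.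
    by case/integrableP : ih.
  by apply: eq_measure_integral => A _ _; exact: count_bij.
rewrite /cintegral; congr (_ +i* _).
  exact: (Rbij (fun k => complex.Re (F k)) (cintegrable_Re iF)).
exact: (Rbij (fun k => complex.Im (F k)) (cintegrable_Im iF)).
Qed.

Lemma bijective_subr m : bijective (fun k => k - m)%R.
Proof. by exists (fun k => k + m)%R => k; rewrite ?subrK ?addrK. Qed.

Lemma bijective_addr m : bijective (fun k => k + m)%R.
Proof. by exists (fun k => k - m)%R => k; rewrite ?subrK ?addrK. Qed.

Lemma bijective_rsub m : bijective (fun k => m - k)%R.
Proof. by exists (fun k => m - k)%R => k; rewrite opprB addrCA subrr addr0. Qed.

Lemma le_integral_count (h : lattice n -> \bar R) k : (forall j, 0 <= h j) ->
  h k <= \int[count]_j h j.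
Proof.
move=> h0; have -> : h k = \int[count]_(j in [set k]) h j.
  rewrite (eq_integral (cst (h k))); last by move=> x /[!inE] ->.
  by rewrite integral_cst// count1 mule1.
apply: ge0_subset_integral => //; exact: measurable_fun_lattice.
Qed.

Lemma cintegral_count_supp1 (F : lattice n -> R[i]) k :
  (forall j, j != k -> F j = 0%R) -> cintegral count F = F k.
Proof.
move=> F0; have supp (h : lattice n -> R) : (forall j, j != k -> h j = 0%R) ->
    (\int[count]_j h j = h k)%R.
  move=> h0; rewrite /Rintegral.
  have -> : \int[count]_j (h j)%:E = \int[count]_(j in [set k]) (h j)%:E.
    rewrite [RHS]integral_mkcond; apply: eq_integral => j _.
    rewrite patchE; case: ifPn => //; rewrite notin_setE/= => /eqP jk.
    by rewrite h0.
  rewrite (eq_integral (cst (h k)%:E)); last by move=> x /[!inE] ->.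
  by rewrite integral_cst// count1 mule1.
rewrite /cintegral (supp (fun j => complex.Re (F j))); last by move=> j /F0 ->.
rewrite (supp (fun j => complex.Im (F j))); last by move=> j /F0 ->.
by case: (F k).
Qed.

End lattice_counting.

(** * Summability of rapidly decreasing weights *)

Section lattice_decay.
Variables (R : realType) (n : nat).
Implicit Types (k m : lattice n).
Local Open Scope classical_set_scope.
Local Notation count := (count_measure R n).
Local Notation nrm := (lattice_norm R).

Lemma lattice_norm_ge0 k : 0 <= nrm k.
Proof. exact: sqrtr_ge0. Qed.

Lemma coord_le_lattice_norm k i : `|(k 0 i)%:~R| <= nrm k :> R.
Proof.
rewrite -sqrtr_sqr; apply: ler_wsqrtr; rewrite (bigD1 i)//= lerDl.
by apply: sumr_ge0 => j _; exact: sqr_ge0.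
Qed.

(** The ball is contained in the cube of points with coordinates in
    [[-N, N]], which is the image of a finite type of matrices. *)
Lemma count_ball_le (N : nat) :
  (count [set k : lattice n | (nrm k < N.+1%:R)%R] <= (((N.*2.+1)%:R ^+ n)%:E : \bar R))%E.
Proof.
(* the points of the cube, the entries being shifted from [[0, 2N]] *)
pose x (f : 'rV['I_N.*2.+1]_n) : lattice n :=
  (\row_i ((f 0 i : nat)%:Z - N%:Z) : 'rV[int]_n).
set B := [set k | _].
have -> : count B = (\int[count]_k (\1_B k)%:E)%E.
  by rewrite integral_indic// setIT.
apply: (@le_trans _ _ (\int[count]_k \sum_(f : 'rV['I_N.*2.+1]_n)
    (\1_[set x f] k)%:E)%E).
  apply: ge0_le_integralT => [k|||k].
  - by rewrite lee_fin.
  - exact: measurable_fun_lattice.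
  - exact: measurable_fun_lattice.
  rewrite indicE; have [|_] /= := boolP (k \in B); last first.
    by apply: sume_ge0 => f _; rewrite lee_fin.
  rewrite inE /B/= => kN.
  have kiN i : (`|k 0 i| <= N%:Z)%R.
    have : (`|k 0 i|%:~R < (N.+1 : int)%:~R :> R)%R.
      by rewrite intr_norm; exact: le_lt_trans (coord_le_lattice_norm k i) kN.
    by rewrite ltr_int; lia.
  have fi i : (`|(k 0 i + N%:Z)%R| < N.*2.+1)%N.
    by have := kiN i; lia.
  pose f : 'rV['I_N.*2.+1]_n := \row_i Ordinal (fi i).
  have xf : x f = k.
    apply/rowP => i; rewrite !mxE /=; have := kiN i; lia.
  by rewrite (bigD1 f)//= xf indicE mem_set// leeDl// sume_ge0.
rewrite ge0_integral_sum// (eq_bigr (fun=> 1%E)); last first.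
  by move=> f _; rewrite integral_indic// setIT count1.
rewrite sumEFin lee_fin sumr_const card_mx card_ord mul1n.
by rewrite -natrX.
Qed.

(** Comparison with the telescoping series of [2 / ((i + 1) (i + 2))]. *)
Lemma sum_inv_sqr_le (N : nat) :
  (\sum_(0 <= i < N) ((i.+1%:R ^+ 2)^-1 : R) <= 2 * (1 - N.+1%:R^-1)).
Proof.
elim: N => [|N IH]; first by rewrite big_nil invr1 subrr mulr0.
rewrite big_nat_recr//= (le_trans (lerD IH (lexx _)))//.
set a : R := N.+1%:R.
have a1 : 1 <= a by rewrite ler1n.
have -> : N.+2%:R = a + 1 :> R by rewrite -natr1.
rewrite -subr_ge0.
have -> : 2 * (1 - (a + 1)^-1) - (2 * (1 - a^-1) + (a ^+ 2)^-1) =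
    (a - 1) / (a ^+ 2 * (a + 1)).
  by field; apply/andP; split; apply/eqP; nra.
by rewrite divr_ge0 ?subr_ge0// mulr_ge0 ?sqr_ge0//; nra.
Qed.

(** The lattice is cut into the shells [N <= nrm k < N + 1], each with
    [O((N + 1) ^ n)] points. *)
Lemma summable_lattice_weight :
  (\int[count]_k ((1 + nrm k) ^- n.+2)%:E < +oo)%E.
Proof.
pose S N : set (lattice n) := (fun k => Num.truncn (nrm k)) @^-1` [set N].
have US : \bigcup_N S N = setT.
  by apply/seteqP; split=> // k _; exists (Num.truncn (nrm k)).
have w0 k : 0 <= (1 + nrm k) ^- n.+2.
  by rewrite invr_ge0 exprn_ge0// addr_ge0// lattice_norm_ge0.
rewrite -US ge0_integral_bigcup//; first last.
- exact: trivIset_preimage1.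
- by move=> k _; rewrite lee_fin.
(* [2 N + 1 <= 2 (N + 1)], so a shell has at most [c * (N + 1) ^ n] points *)
pose c : R := 2 ^+ n.
have SN N : (\int[count]_(k in S N) ((1 + nrm k) ^- n.+2)%:E <=
    c%:E * ((N.+1%:R ^+ 2)^-1)%:E)%E.
  apply: (@le_trans _ _ (\int[count]_(k in S N) (cst (N.+1%:R ^- n.+2)%:E) k)%E).
    apply: ge0_le_integral => //.
    - by move=> k _; rewrite lee_fin.
    - move=> k; rewrite /S/= => <-; rewrite lee_fin lef_pV2 ?posrE.
      + rewrite lerXn2r ?nnegrE//; first by rewrite addr_ge0 ?lattice_norm_ge0.
        by rewrite -natr1 addrC lerD2l; case/andP: (truncn_itv (lattice_norm_ge0 k)).
      + by rewrite exprn_gt0// ltr_wpDr// lattice_norm_ge0.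
      + by rewrite exprn_gt0.
  rewrite integral_cst//.
  apply: (@le_trans _ _ ((N.+1%:R ^- n.+2)%:E * ((N.*2.+1)%:R ^+ n)%:E)%E).
    rewrite lee_wpmul2l//.
    apply: le_trans (count_ball_le N); apply: le_measure; rewrite ?inE//.
    move=> k; rewrite /S/= => <-.
    by case/andP: (truncn_itv (lattice_norm_ge0 k)).
  rewrite -!EFinM lee_fin -(addn2 n) exprD invfM mulrAC ler_wpM2r//.
  rewrite mulrC ler_pdivrMr ?exprn_gt0// -exprMn lerXn2r ?nnegrE//.
  by rewrite -natrM ler_nat; lia.
apply: (@le_lt_trans _ _ (c%:E * 2%:E)%E); last by rewrite -EFinM ltry.
apply: (@le_trans _ _ (\sum_(0 <= N <oo) (c%:E * ((N.+1%:R ^+ 2)^-1)%:E))%E).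
  by apply: lee_nneseries => // N _ _; apply: integral_ge0 => k _; rewrite lee_fin.
have t0 (N : nat) : (0 <= ((N.+1%:R ^+ 2)^-1 : R)%:E)%E.
  by rewrite lee_fin invr_ge0 sqr_ge0.
rewrite nneseriesZl// lee_wpmul2l//; first by rewrite lee_fin exprn_ge0.
apply: lime_le; first by apply: is_cvg_nneseries => N _ _; exact: t0.
apply: nearW => N; rewrite sumEFin lee_fin (le_trans (sum_inv_sqr_le N))//.
by rewrite -[leRHS]mulr1 ler_wpM2l// gerBl invr_ge0.
Qed.

(** A weak triangle inequality: it makes the polynomial weights moderate,
    which is all that is needed to translate a Schwartz function. *)
Lemma lattice_norm_shift k m : 1 + nrm k <= 2 * ((1 + nrm m) * (1 + nrm (k - m))).
Proof.
have kE : nrm k <= 2 * (nrm (k - m) + nrm m).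
  rewrite -(@ler_pXn2r _ 2)// ?nnegrE ?lattice_norm_ge0//; last first.
    by rewrite mulr_ge0// addr_ge0// lattice_norm_ge0.
  have sqE (j : lattice n) : nrm j ^+ 2 = \sum_(i < n) (j 0 i)%:~R ^+ 2.
    by rewrite sqr_sqrtr// sumr_ge0// => i _; exact: sqr_ge0.
  have a0 := lattice_norm_ge0 m; have b0 := lattice_norm_ge0 (k - m).
  have ab := mulr_ge0 a0 b0.
  apply: (@le_trans _ _ (2 * (nrm (k - m) ^+ 2 + nrm m ^+ 2))); last by nra.
  rewrite !sqE -big_split mulr_sumr; apply: ler_sum => i _ /=.
  have -> : (k - m : lattice n) 0 i = k 0 i - m 0 i.
    by rewrite -[LHS]/((k - m : 'rV[int]_n) 0 i) !mxE.
  rewrite intrB; set x : R := (k 0 i)%:~R; set y : R := (m 0 i)%:~R.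
  rewrite -subr_ge0.
  have -> : 2 * ((x - y) ^+ 2 + y ^+ 2) - x ^+ 2 = (x - 2 * y) ^+ 2 by ring.
  exact: sqr_ge0.
have a0 := lattice_norm_ge0 m; have b0 := lattice_norm_ge0 (k - m).
have ab := mulr_ge0 a0 b0.
by nra.
Qed.

End lattice_decay.

(** * Translation invariance on the torus *)

Section torus_translation.
Variable R : realType.
Local Open Scope classical_set_scope.
Local Open Scope ereal_scope.

Lemma measurable_subr (c : R) :
  measurable_fun setT (fun x : measurableTypeR R => (x - c)%R : measurableTypeR R).
Proof. by apply: measurable_funD => //; exact: measurable_cst. Qed.

(** Lebesgue measure is determined by its values on the intervals [`]a, b]],
    and translation preserves the length of those. *)
Lemma lebesgue_measure_preimage_subr (c : R) (A : set (measurableTypeR R)) :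
  measurable A ->
  lebesgue_measure ((fun x => (x - c)%R) @^-1` A) = lebesgue_measure A.
Proof.
move=> mA; have mc := measurable_subr c.
rewrite [RHS](@lebesgue_measure_unique _
  (pushforward (@lebesgue_measure R) (fun x : measurableTypeR R => (x - c)%R : measurableTypeR R)))//.
move=> _ [[a b] _ <-] /=; rewrite /pushforward.
have -> : (fun x : R => (x - c)%R) @^-1` `]a, b] = `](a + c)%R, (b + c)%R]%classic.
  by apply/seteqP; split=> x /=; rewrite !in_itv/= ltrBrDr lerBlDr.
rewrite !lebesgue_measure_itv/= !lte_fin ltrD2r; case: ifP => // _.
by rewrite -!EFinD; congr (_%:E); rewrite opprD addrACA subrr addr0.
Qed.

(** Translation by [- a] on the circle, transported to its fundamental domain
    [[0, 1)]. *)
Definition circle_sub (a x : measurableTypeR R) : measurableTypeR R :=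
  (if (x < a)%R then x - a + 1 else x - a)%R.

Lemma measurable_circle_sub a : measurable_fun setT (circle_sub a).
Proof.
apply: (@measurable_fun_ifT _ _ _ _ (fun x : measurableTypeR R => (x - a + 1)%R : R)
  (fun x : measurableTypeR R => (x - a)%R : R) (fun x => x < a)%R).
- exact: measurable_fun_ltr.
- by apply: (@measurable_funD _ _ R); [exact: (@measurable_subr a)|exact: measurable_cst].
- exact: (@measurable_subr a).
Qed.

(** The map exchanges the two pieces into which [1 - a] cuts [[0, 1)], each of
    them by a translation of the line. *)
Lemma haar1_circle_sub (a : R) (A : set (measurableTypeR R)) :
  (0 <= a < 1)%R -> measurable A ->
  haar1 (circle_sub a @^-1` A) = haar1 A.
Proof.
move=> /andP[a0 a1] mA; rewrite /haar1 /= /mrestr.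
have mI (b c : R) :
    measurable (A `&` `[b, c[%classic : set (measurableTypeR R)).
  by apply: measurableI => //; exact: measurable_itv.
have -> : A `&` `[0%R, 1%R[%classic =
    (A `&` `[0%R, (1 - a)%R[%classic) `|` (A `&` `[(1 - a)%R, 1%R[%classic).
  rewrite -setIUr; congr (_ `&` _).
  by rewrite -itv_bndbnd_setU// bnd_simp; lra.
have -> : circle_sub a @^-1` A `&` `[0%R, 1%R[%classic =
    ((fun x => x - a)%R @^-1` (A `&` `[0%R, (1 - a)%R[%classic)) `|`
    ((fun x => x - (a - 1))%R @^-1` (A `&` `[(1 - a)%R, 1%R[%classic)).
  apply/seteqP; split=> x /=; rewrite !in_itv/= /circle_sub.
    move=> [+ /andP[x0 x1]]; case: ifPn => [xa Ax|]; last first.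
      by rewrite -leNgt => ax Ax; left; split=> //; lra.
    by right; rewrite opprB addrA addrAC; split=> //; lra.
  move=> [[Ax /andP[xa x1]]|[Ax /andP[xa x1]]].
    by rewrite ifF; [split=> //; lra|lra].
  rewrite ifT; last lra.
  by split; [move: Ax; rewrite opprB addrA addrAC|lra].
have mpre c (B : set (measurableTypeR R)) : measurable B ->
    measurable ((fun x : measurableTypeR R => x - c)%R @^-1` B).
  by move=> mB; rewrite -[X in measurable X]setTI; exact: measurable_subr.
rewrite !measureU//; first last.
- by apply/seteqP; split=> x //= [[_ +] [_ ]]; rewrite !in_itv/=; lra.
- exact: mpre.
- exact: mpre.
- by apply/seteqP; split=> x //= [[_ +] [_ ]]; rewrite !in_itv/=; lra.
by congr (_ + _)%R; exact: lebesgue_measure_preimage_subr.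
Qed.

Lemma haar1_translation (F : measurableTypeR R -> \bar R) (a : R) :
  measurable_fun setT F -> (forall x, 0 <= F x) ->
  (forall x (j : int), F (x - j%:~R)%R = F x) ->
  \int[haar1 (R:=R)]_x F (x - a)%R = \int[haar1 (R:=R)]_x F x.
Proof.
move=> mF F0 Fper.
(* only the fractional part of [a] matters, by periodicity *)
pose b : R := (a - (Num.floor a)%:~R)%R.
have b01 : (0 <= b < 1)%R.
  have /andP[] := floor_itv a; rewrite intrD /b; lra.
have mb := measurable_circle_sub b.
transitivity (\int[haar1 (R:=R)]_x F (circle_sub b x)).
  apply: eq_integral => x _; rewrite /circle_sub.
  case: ifP => _.
    rewrite -[LHS](Fper _ (- Num.floor a - 1)%R); congr F.
    by rewrite /b intrB intrN; ring.
  rewrite -[LHS](Fper _ (- Num.floor a)%R); congr F.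
  by rewrite /b intrN; ring.
transitivity (\int[pushforward (haar1 (R:=R)) (circle_sub b)]_x F x).
  by rewrite ge0_integral_pushforward.
by apply: eq_measure_integral => A mA _; exact: haar1_circle_sub.
Qed.

Definition torus_sub n (w v : torus R n) : torus R n :=
  [tuple tnth w i - tnth v i | i < n]%R.

Definition torus_periodic n (U : Type) (F : torus R n -> U) : Prop :=
  forall w v, (forall i, exists j : int, tnth v i = j%:~R) ->
  F (torus_sub w v) = F w.

Lemma tnth_torus_sub n (w v : torus R n) i :
  tnth (torus_sub w v) i = (tnth w i - tnth v i)%R.
Proof. by rewrite tnth_mktuple. Qed.

Lemma measurable_torus_sub n d (T : measurableType d) (f h : T -> torus R n) :
  measurable_fun setT f -> measurable_fun setT h ->
  measurable_fun setT (fun x => torus_sub (f x) (h x)).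
Proof.
move=> mf mh; apply/measurable_fun_tnthP => i.
rewrite (_ : _ \o _ = (fun x => tnth (f x) i) \- (fun x => tnth (h x) i))%R.
  apply: measurable_funB.
    exact: (measurableT_comp (measurable_tnth i) mf).
  exact: (measurableT_comp (measurable_tnth i) mh).
by apply/funext => x; rewrite /= tnth_torus_sub.
Qed.

Lemma torus_sub_cons n (x y : R) (t u : torus R n) :
  torus_sub (torus_cons (x, t)) (torus_cons (y, u)) =
  torus_cons ((x - y)%R, torus_sub t u).
Proof.
apply: eq_from_tnth => i; rewrite tnth_torus_sub.
case: (unliftP ord0 i) => [j|] ->; last by rewrite !tnth0.
by rewrite /torus_cons/= !tnthS tnth_torus_sub.
Qed.

(** Invariance holds for periodic functions only, since the torus is
    represented by a fundamental domain. By Tonelli's theorem the last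
    coordinates are translated first, with the first one fixed, and then the
    first coordinate. *)
Lemma haar_translation n (F : torus R n -> \bar R) (v : torus R n) :
  measurable_fun setT F -> (forall w, 0 <= F w) -> torus_periodic F ->
  \int[haar R n]_w F (torus_sub w v) = \int[haar R n]_w F w.
Proof.
elim: n F v => [|n IH] F v mF F0 Fper.
  by apply: eq_integral => w _; congr F; apply: eq_from_tnth => -[].
have mcons := @measurable_torus_cons R n.
have intP (y : R) (u : torus R n) : (exists j : int, y = j%:~R) ->
    (forall i, exists j : int, tnth u i = j%:~R) ->
    forall i, exists j : int, tnth (torus_cons (y, u)) i = j%:~R.
  move=> yj uj i; case: (unliftP ord0 i) => [j|] ->; last by rewrite tnth0.
  by rewrite /torus_cons/= tnthS.
pose v0 := thead v; pose u : torus R n := [tuple of behead v].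
have vE : v = torus_cons (v0, u) by rewrite [LHS]tuple_eta; exact: val_inj.
have msub : measurable_fun setT (fun w : torus R n.+1 => F (torus_sub w v)).
  by apply: (measurableT_comp mF); exact: measurable_torus_sub.
have consE (G : torus R n.+1 -> \bar R) : measurable_fun setT G ->
    (forall w, 0 <= G w) ->
    \int[haar R n.+1]_w G w =
    \int[(haar1 (R:=R) \x haar R n)%E]_z G (torus_cons z).
  by move=> mG G0; rewrite ge0_integral_pushforward.
rewrite !consE//.
have mFc : measurable_fun setT (F \o @torus_cons R n) by exact: measurableT_comp.
rewrite (fubini_tonelli1 (fun z => F (torus_sub (torus_cons z) v)))//; last first.
  exact: (measurableT_comp msub mcons).
rewrite (fubini_tonelli2 (F \o @torus_cons R n))//.
transitivity (\int[haar1 (R:=R)]_x \int[haar R n]_t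
    F (torus_cons ((x - v0)%R, t))).
  apply: eq_integral => x _; rewrite /fubini_F.
  have subE t : torus_sub (torus_cons (x, t)) v =
      torus_cons ((x - v0)%R, torus_sub t u).
    by rewrite -torus_sub_cons -vE.
  under eq_integral do rewrite subE.
  apply: (IH (fun t => F (torus_cons ((x - v0)%R, t)))) => //.
    apply: (measurableT_comp mFc); exact: measurable_pair1.
  move=> t w wj; rewrite -[y in (y, _)]subr0 -torus_sub_cons Fper//.
  by apply: intP => //; exists 0%R.
rewrite (fubini_tonelli (fun z : measurableTypeR R * torus R n =>
    F (torus_cons (((z.1 : R) - v0)%R, z.2))))//; last first.
  apply: (measurableT_comp mFc).
  apply/measurable_fun_pairP; split.
    exact: (measurableT_comp (@measurable_subr v0) measurable_fst).
  exact: measurable_snd.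
apply: eq_integral => t _; rewrite /fubini_G.
apply: (haar1_translation (F := fun x => F (torus_cons (x, t)))) => //.
  apply: (measurableT_comp mFc); exact: measurable_pair2.
move=> x j.
pose z : torus R n := [tuple 0%R | i < n].
have tz : torus_sub t z = t.
  by apply: eq_from_tnth => i; rewrite tnth_torus_sub tnth_mktuple subr0.
rewrite -[X in (_, X)]tz -torus_sub_cons Fper//; apply: intP; first by exists j.
by move=> i; exists 0%R; rewrite tnth_mktuple.
by move=> x; exact: F0.
Qed.

End torus_translation.

(** * Characters of the torus *)

Section characters.
Variables (R : realType) (n : nat).
Implicit Types (k m : lattice n) (w v : torus R n).
Local Open Scope classical_set_scope.

Lemma dot0 w : dot w 0 = 0.
Proof.
rewrite /dot big1// => i _.
by rewrite -[X in _ * X%:~R]/((0 : 'rV[int]_n) 0 i) mxE mulr0.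
Qed.

Lemma dotD w k m : dot w (k + m) = dot w k + dot w m.
Proof.
rewrite /dot -big_split; apply: eq_bigr => i _ /=.
by rewrite -[X in _ * X%:~R]/((k + m : 'rV[int]_n) 0 i) mxE intrD mulrDr.
Qed.

Lemma dotN w k : dot w (- k) = - dot w k.
Proof.
by apply/eqP; rewrite -addr_eq0 -dotD addNr dot0.
Qed.

Lemma dot_sub w v k : dot (torus_sub w v) k = dot w k - dot v k.
Proof.
rewrite /dot -sumrB; apply: eq_bigr => i _.
by rewrite tnth_torus_sub mulrBl.
Qed.

Lemma measurable_dot k : measurable_fun setT (fun w => dot w k).
Proof.
apply: measurable_sum => i; apply: measurable_funM; last exact: measurable_cst.
exact: measurable_tnth.
Qed.

Lemma cis_int (j : int) : cis j%:~R = 1 :> R[i].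
Proof.
have cis1 : cis 1 = 1 :> R[i].
  by rewrite /cis mulr1 mulr_natl cos2pi sin2pi.
have cisn (l : nat) : cis l%:R = 1 :> R[i].
  elim: l => [|l IH]; first exact: cis0.
  by rewrite -natr1 cisD IH cis1 mulr1.
case: j => l; first exact: cisn.
by rewrite NegzE mulrNz cisN cisn conjC1.
Qed.

Lemma dot_int v k : (forall i, exists j : int, tnth v i = j%:~R) ->
  exists j : int, dot v k = j%:~R.
Proof.
move=> vj; rewrite /dot; elim/big_rec : _ => [|i x _ [j ->]].
  by exists 0.
by have [l ->] := vj i; exists (l * k 0 i + j); rewrite intrD intrM.
Qed.

Lemma torus_periodic_character k : torus_periodic (fun w : torus R n => cis (dot w k)).
Proof.
move=> w v /(dot_int k)[j vj].
by rewrite dot_sub vj cisD -intrN cis_int mulr1.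
Qed.

Lemma measurable_cos : measurable_fun setT (@cos R).
Proof. by apply: continuous_measurable_fun; exact: continuous_cos. Qed.

Lemma measurable_sin : measurable_fun setT (@sin R).
Proof. by apply: continuous_measurable_fun; exact: continuous_sin. Qed.

Lemma cmeasurable_character k : cmeasurable (fun w : torus R n => cis (dot w k)).
Proof.
have m2 : measurable_fun setT (fun w : torus R n => 2 * pi * dot w k).
  by apply: measurable_funM; [exact: measurable_cst|exact: measurable_dot].
split; first exact: (measurableT_comp measurable_cos m2).
exact: (measurableT_comp measurable_sin m2).
Qed.

Lemma haar_integrable_bounded (F : torus R n -> R[i]) (C : R) :
  cmeasurable F -> (forall w, cabs (F w) <= C) -> cintegrable (haar R n) F.
Proof.
move=> mF FC; apply: (@le_cintegrable _ _ _ _ _ (cst C)) => //.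
rewrite (_ : (fun x => _) = cst C%:E)//.
by rewrite integral_cst// [X in (_ * X)%E](_ : _ = 1%E) ?mule1 ?ltry//; exact: probability_setT.
Qed.

Lemma cintegrable_character k : cintegrable (haar R n) (fun w => cis (dot w k)).
Proof.
apply: (@haar_integrable_bounded _ 1); first exact: cmeasurable_character.
by move=> w; rewrite cabs_cis.
Qed.

(** A frequency [k != 0] admits a translation of the torus that changes the
    sign of the character; by invariance its integral is then its own
    opposite. *)
Lemma integral_character k :
  cintegral (haar R n) (fun w => cis (dot w k)) = (k == 0)%:R.
Proof.
have [->|k0] := eqVneq k 0.
  rewrite (eq_cintegral _ (G := fun=> 1)); last by move=> w; rewrite dot0 cis0.
  rewrite /cintegral/= !Rintegral_cst//= mul0r mul1r.
  by rewrite [X in fine X](_ : _ = 1%E)//; exact: probability_setT.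
have [i ki] : exists i, k 0 i != 0.
  apply: contrapT => /forallNP k0'; move/eqP: k0; apply; apply/rowP => i.
  rewrite -[RHS]/((0 : 'rV[int]_n) 0 i) mxE.
  by have /negP := k0' i; rewrite negbK => /eqP.
(* [v] is chosen so that [dot v k = 1 / 2], where the character is [-1] *)
pose v : torus R n := [tuple (if j == i then (2 * (k 0 i)%:~R)^-1 else 0) | j < n].
have kiR : (k 0 i)%:~R != 0 :> R by rewrite intr_eq0.
have vk : dot v k = 2^-1.
  rewrite /dot (bigD1 i)//= tnth_mktuple eqxx big1 ?addr0; last first.
    by move=> j /negPf ji; rewrite tnth_mktuple ji mul0r.
  by rewrite invfM mulfVK.
have cv : cis (- dot v k) = -1 :> R[i].
  rewrite vk /cis mulrN mulrAC divff// mul1r cosN sinN cospi sinpi.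
  by apply/eqP; rewrite eq_complex/= !oppr0 !eqxx.
have neg (h : torus R n -> R) : measurable_fun setT h -> (forall w, `|h w| <= 1) ->
    torus_periodic h -> (forall w, h (torus_sub w v) = - h w) ->
    (\int[haar R n]_w h w = 0)%R.
  move=> mh h1 hper hv.
  have bh (c : R) : (haar R n).-integrable setT (EFin \o (fun w => c * h w)).
    apply: measurable_bounded_integrable => //.
    - by rewrite [X in (X < _)%E](_ : _ = 1%E) ?ltry//; exact: probability_setT.
    - by apply: measurable_funM => //; exact: measurable_cst.
    - exists `|c|; split => // x cx w _ /=.
      rewrite normrM (le_trans _ (ltW cx))//.
      by rewrite -[leRHS]mulr1 ler_wpM2l.
  have b1 : (haar R n).-integrable setT (EFin \o cst 1).
    exact: finite_measure_integrable_cst.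
  have ih : (haar R n).-integrable setT (EFin \o h).
    by apply: eq_integrable (bh 1) => // w _; rewrite /= mul1r.
  have ihN : (haar R n).-integrable setT (EFin \o (fun w => - h w)).
    by apply: eq_integrable (bh (-1)) => // w _; rewrite /= mulN1r.
  have : (\int[haar R n]_w (1 + h w))%R = (\int[haar R n]_w (1 - h w))%R.
    congr fine; symmetry.
    under eq_integral do rewrite -hv.
    (* invariance is stated for nonnegative functions, hence the shift by 1 *)
    apply: (haar_translation (F := fun w => (1 + h w)%:E)).
    - by apply/measurable_EFinP; apply: measurable_funD => //; exact: measurable_cst.
    - by move=> w; rewrite lee_fin; have := h1 w; rewrite ler_norml; lra.
    - by move=> w u uj; rewrite hper.
  rewrite RintegralD// [in RHS]RintegralD//.
  have -> : (\int[haar R n]_w (- h w))%R = - (\int[haar R n]_w h w)%R.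
    rewrite -mulN1r -RintegralZl//; apply: eq_Rintegral => w _.
    by rewrite mulN1r.
  by move=> /addrI /eqP; rewrite -addr_eq0 -mulr2n mulrn_eq0/= => /eqP.
have [mR mI] := cmeasurable_character k.
have shift w : cis (dot (torus_sub w v) k) = - cis (dot w k).
  by rewrite dot_sub cisD cv mulrN1.
rewrite /cintegral !neg//.
- by move=> w; rewrite (le_trans (cabs_Im _))// cabs_cis.
- by move=> w u uj; rewrite torus_periodic_character.
- by move=> w; rewrite shift; case: (cis _).
- by move=> w; rewrite (le_trans (cabs_Re _))// cabs_cis.
- by move=> w u uj; rewrite torus_periodic_character.
- by move=> w; rewrite shift; case: (cis _).
Qed.

End characters.

(** * Absolutely convergent Fourier series *)

Section fourier_series.
Variables (R : realType) (n : nat).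
Implicit Types (k m l : lattice n) (w v : torus R n) (a : lattice n -> R[i]).
Local Open Scope classical_set_scope.
Local Notation count := (count_measure R n).

Definition fourier a w : R[i] :=
  cintegral count (fun k => a k * (cis (dot w k))^*).

Lemma cintegrable_count_bound a (b : lattice n -> R) :
  (forall k, cabs (a k) <= b k) -> (\int[count]_k (b k)%:E < +oo)%E ->
  cintegrable count a.
Proof.
by move=> ab; apply: le_cintegrable => //; exact: cmeasurable_lattice.
Qed.

Lemma cintegrable_fourier a w : cintegrable count a ->
  cintegrable count (fun k => a k * (cis (dot w k))^*).
Proof.
move=> [_ ia]; apply: cintegrable_count_bound ia => k.
by rewrite cabsM cabs_conj cabs_cis mulr1.
Qed.

Lemma integral_cabsMr_lty d (T : measurableType d)
    (mu : {measure set T -> \bar R}) (F : T -> R[i]) (C : R) :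
  cintegrable mu F -> (\int[mu]_x (cabs (F x) * C)%:E < +oo)%E.
Proof.
move=> [mF iF]; under eq_integral do rewrite mulrC EFinM.
have iF' : mu.-integrable setT (fun x => (cabs (F x))%:E).
  apply/integrableP; split; first exact: measurable_cabs_EFin.
  by under eq_integral do rewrite gee0_abs ?lee_fin ?cabs_ge0//.
by rewrite integralZl// -[X in (_ * X)%E]fineK ?integrable_fin_num// -EFinM ltry.
Qed.

(** The absolute convergence under which a sum over the lattice may be exchanged
    with an integral. *)
Lemma cintegrable_lattice_prod d (T : measurableType d)
    (mu : {sigma_finite_measure set T -> \bar R}) a (F : T -> R[i])
    (phi : lattice n -> T -> R[i]) (C : R) :
  cintegrable count a -> cintegrable mu F ->
  (forall k, cmeasurable (phi k)) -> (forall k x, cabs (phi k x) <= C) ->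
  cintegrable (count_sigma_finite R n \x mu)%E
    (fun z => a z.1 * (F z.2 * phi z.1 z.2)).
Proof.
move=> [_ ia] iF mphi phi1.
have mk k : cmeasurable (fun x => a k * (F x * phi k x)).
  apply: cmeasurableM; first exact: cmeasurable_cst.
  by apply: cmeasurableM => //; exact: iF.1.
apply: cintegrable_prod; first exact: cmeasurable_lattice_prod.
have F0 x : (0 <= (cabs (F x) * C)%:E)%E.
  by rewrite lee_fin mulr_ge0 ?cabs_ge0// (le_trans (cabs_ge0 (phi 0 x))).
have mF : measurable_fun setT (fun x => (cabs (F x) * C)%:E).
  apply/measurable_EFinP; apply: measurable_funM; last exact: measurable_cst.
  exact: cmeasurable_cabs iF.1.
have iFC := integral_cabsMr_lty C iF.
apply: (@le_lt_trans _ _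
    (\int[count]_k ((cabs (a k))%:E * \int[mu]_x (cabs (F x) * C)%:E))%E).
  apply: ge0_le_integralT => [k|||k].
  - by apply: integral_ge0 => x _; rewrite lee_fin cabs_ge0.
  - exact: measurable_fun_lattice.
  - exact: measurable_fun_lattice.
  rewrite -ge0_integralZl//; last by rewrite lee_fin cabs_ge0.
  apply: ge0_le_integralT => [x|||x].
  - by rewrite lee_fin cabs_ge0.
  - exact: measurable_cabs_EFin (mk k).
  - exact: measurable_funeM.
  - rewrite /= !cabsM -EFinM lee_fin ler_wpM2l ?cabs_ge0//.
    by rewrite ler_wpM2l ?cabs_ge0.
rewrite ge0_integralZr//.
- have a0 : (0 <= \int[count]_k (cabs (a k))%:E)%E.
    by apply: integral_ge0 => k _; rewrite lee_fin cabs_ge0.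
  by apply: lte_mul_pinfty => //; rewrite ge0_fin_numE.
- by move=> k _; rewrite lee_fin cabs_ge0.
- exact: integral_ge0.
Qed.

Lemma cmeasurable_fourier a : cintegrable count a -> cmeasurable (fourier a).
Proof.
move=> ia.
have i1 : cintegrable (haar R n) (fun=> 1).
  apply: (@haar_integrable_bounded _ _ _ 1); first exact: cmeasurable_cst.
  by move=> w; rewrite cabs1.
have := @cintegrable_lattice_prod _ _ (haar R n) a (fun=> 1)
  (fun k w => (cis (dot w k))^*) 1 ia i1.
have mc k : cmeasurable (fun w : torus R n => (cis (dot w k))^*).
  by apply: cmeasurable_conj; exact: cmeasurable_character.
have c1 k w : cabs (cis (dot w k))^* <= 1 by rewrite cabs_conj cabs_cis.
move=> /(_ mc c1) /cmeasurable_cintegral1.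
suff -> : fourier a = (fun w => cintegral (count_sigma_finite R n)
    (fun k => a k * (1 * (cis (dot w k))^*))) by [].
by apply/funext => w; apply: eq_cintegral => k; rewrite mul1r.
Qed.

Lemma fourier_le a w : cintegrable count a ->
  ((cabs (fourier a w))%:E <= \int[count]_k (cabs (a k))%:E)%E.
Proof.
move=> ia; apply: (le_trans (cabs_cintegral_le (cintegrable_fourier w ia))).
apply: ge0_le_integralT => // [k|k]; first by rewrite lee_fin cabs_ge0.
by rewrite cabsM cabs_conj cabs_cis mulr1.
Qed.

Lemma fourier_bounded a : cintegrable count a ->
  exists C, forall w, cabs (fourier a w) <= C.
Proof.
move=> ia; exists (fine (\int[count]_k (cabs (a k))%:E)) => w.
rewrite -lee_fin fineK; first exact: fourier_le.
rewrite ge0_fin_numE; first exact: ia.2.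
by apply: integral_ge0 => k _; rewrite lee_fin cabs_ge0.
Qed.

Lemma fourier_torus_periodic a : torus_periodic (fourier a).
Proof.
move=> w v vj; apply: eq_cintegral => k.
by rewrite (torus_periodic_character k).
Qed.

Lemma integral_fourier a (F : torus R n -> R[i]) :
  cintegrable count a -> cintegrable (haar R n) F ->
  cintegral (haar R n) (fun w => fourier a w * F w) =
  cintegral count (fun k => a k *
    cintegral (haar R n) (fun w => F w * (cis (dot w k))^*)).
Proof.
move=> ia iF.
have mc k : cmeasurable (fun w : torus R n => (cis (dot w k))^*).
  by apply: cmeasurable_conj; exact: cmeasurable_character.
have c1 k w : cabs (cis (dot w k))^* <= 1 by rewrite cabs_conj cabs_cis.
have iP := @cintegrable_lattice_prod _ _ (haar R n) a F
  (fun k w => (cis (dot w k))^*) 1 ia iF mc c1.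
transitivity (cintegral (haar R n) (fun w => cintegral (count_sigma_finite R n)
    (fun k => a k * (F w * (cis (dot w k))^*)))).
  apply: eq_cintegral => w; rewrite mulrC -cintegralZl; last exact: cintegrable_fourier.
  by apply: eq_cintegral => k; rewrite mulrCA.
rewrite (cintegral21_prod iP) -(cintegral12_prod iP).
apply: eq_cintegral => k; rewrite -cintegralZl//.
apply: (le_cintegrable (h := fun w => cabs (F w))).
- by apply: cmeasurableM; [exact: iF.1|exact: mc].
- exact: cmeasurable_cabs iF.1.
- by move=> w; rewrite cabsM cabs_conj cabs_cis mulr1.
- exact: iF.2.
Qed.

(** Exchange sum and integral; by orthogonality of the characters a single
    term survives. *)
Lemma fourier_coef a l : cintegrable count a ->
  cintegral (haar R n) (fun w => fourier a w * cis (dot w l)) = a l.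
Proof.
move=> ia; rewrite integral_fourier//; last exact: cintegrable_character.
have int k : cintegral (haar R n)
    (fun w => cis (dot w l) * (cis (dot w k))^*) = (k == l)%:R.
  rewrite (eq_cintegral _ (G := fun w => cis (dot w (l - k)))).
    by rewrite integral_character subr_eq0 eq_sym.
  by move=> w; rewrite dotD dotN cisD cisN.
rewrite (@cintegral_count_supp1 _ _ _ l) => [|k kl].
  by rewrite int eqxx mulr1.
by rewrite int (negPf kl) mulr0.
Qed.

Lemma cintegrable_fourier_haar a : cintegrable count a ->
  cintegrable (haar R n) (fourier a).
Proof.
move=> ia; have [C aC] := fourier_bounded ia.
by apply: haar_integrable_bounded aC; exact: cmeasurable_fourier.
Qed.

Lemma norm_fourier_coef_le a l : cintegrable count a ->
  ((cabs (a l))%:E <= \int[haar R n]_w (cabs (fourier a w))%:E)%E.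
Proof.
move=> ia; have mf := cmeasurable_fourier ia.
have [C aC] := fourier_bounded ia.
rewrite -[in leLHS](fourier_coef l ia).
have -> : (\int[haar R n]_w (cabs (fourier a w))%:E =
    \int[haar R n]_w (cabs (fourier a w * cis (dot w l)))%:E)%E.
  by apply: eq_integral => w _; rewrite cabsM cabs_cis mulr1.
apply: cabs_cintegral_le; apply: (@haar_integrable_bounded _ _ _ C).
  by apply: cmeasurableM => //; exact: cmeasurable_character.
by move=> w; rewrite cabsM cabs_cis mulr1.
Qed.

Lemma cintegrable_sqr d (T : measurableType d)
    (mu : {measure set T -> \bar R}) (F : T -> R[i]) (C : R) :
  cintegrable mu F -> (forall x, cabs (F x) <= C) ->
  cintegrable mu (fun x => F x * (F x)^*).
Proof.
move=> [mF iF] FC.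
apply: (le_cintegrable (h := fun x => cabs (F x) * C)).
- by apply: cmeasurableM => //; exact: cmeasurable_conj.
- by apply: measurable_funM; [exact: cmeasurable_cabs|exact: measurable_cst].
- by move=> x; rewrite cabsM cabs_conj ler_wpM2l ?cabs_ge0.
- exact: integral_cabsMr_lty.
Qed.

Lemma integral_sqr_cabs d (T : measurableType d)
    (mu : {measure set T -> \bar R}) (F : T -> R[i]) :
  cintegrable mu (fun x => F x * (F x)^*) ->
  (\int[mu]_x (cabs (F x) ^+ 2)%:E =
   (complex.Re (cintegral mu (fun x => F x * (F x)^*)))%:E)%E.
Proof.
move=> iF; rewrite /= /Rintegral fineK; last first.
  by apply: integrable_fin_num => //; exact: (cintegrable_Re iF).
by apply: eq_integral => x _; rewrite sqr_cabs.
Qed.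

(** Integrating the series of [a] against its conjugate replaces the latter by
    the conjugates of its Fourier coefficients, which are the [a k]. *)
Lemma parseval a : cintegrable count a ->
  (\int[haar R n]_w (cabs (fourier a w) ^+ 2)%:E =
   \int[count]_k (cabs (a k) ^+ 2)%:E)%E.
Proof.
move=> ia; have [C fC] := fourier_bounded ia.
have ifo := cintegrable_fourier_haar ia.
have aC k : cabs (a k) <= fine (\int[count]_k (cabs (a k))%:E)%E.
  rewrite -lee_fin fineK.
    apply: (le_integral_count (h := fun k => (cabs (a k))%:E)) => j.
    by rewrite lee_fin cabs_ge0.
  rewrite ge0_fin_numE; first exact: ia.2.
  by apply: integral_ge0 => j _; rewrite lee_fin cabs_ge0.
rewrite !integral_sqr_cabs; [|exact: cintegrable_sqr aC|exact: cintegrable_sqr fC].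
congr (complex.Re _)%:E.
rewrite integral_fourier//; last exact: cintegrable_conj.
apply: eq_cintegral => k; congr (_ * _).
rewrite -[in RHS](fourier_coef k ia) -cintegral_conj; last first.
  apply: (@haar_integrable_bounded _ _ _ C).
    apply: cmeasurableM; first exact: cmeasurable_fourier.
    exact: cmeasurable_character.
  by move=> w; rewrite cabsM cabs_cis mulr1.
by apply: eq_cintegral => w; rewrite conjCM.
Qed.

End fourier_series.

(** * Superpositions in Lebesgue spaces *)

Section kernel_operator.
Context d (T : measurableType d) (R : realType).
Local Open Scope ereal_scope.

Lemma ge0_le_poweR (r : R) (x y : \bar R) : (0 <= r)%R -> 0 <= x -> x <= y ->
  x `^ r <= y `^ r.
Proof.
move=> r0 x0 xy; apply: gt0_ler_poweR => //; rewrite in_itv/= leey andbT//.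
exact: le_trans xy.
Qed.

(** Jensen's inequality for the (unnormalized) measure [W mu], obtained from
    Hoelder's inequality for the factorization
    [W * K = W ^ (1/q) * (W ^ (1/p) * K)]. *)
Lemma weighted_jensen (mu : {measure set T -> \bar R}) (p : R) (W K : T -> R) :
  (1 <= p)%R -> measurable_fun setT W -> measurable_fun setT K ->
  (forall x, 0 <= W x)%R -> (forall x, 0 <= K x)%R ->
  (\int[mu]_x (W x * K x)%:E) `^ p <=
  (\int[mu]_x (W x)%:E) `^ (p - 1) * \int[mu]_x (W x * K x `^ p)%:E.
Proof.
move=> p1 mW mK W0 K0; have [->|pn1] := eqVneq p 1%R.
  rewrite poweRe1; last by apply: integral_ge0 => x _; rewrite lee_fin mulr_ge0.
  rewrite subrr poweRe0 mul1e le_eqVlt; apply/orP; left; apply/eqP.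
  by apply: eq_integral => x _; rewrite powRr1.
have {p1 pn1}p1 : (1 < p)%R by rewrite lt_neqAle eq_sym pn1.
have p0 : (0 < p)%R by rewrite (lt_trans ltr01).
have pN0 : p != 0%R by rewrite gt_eqF.
have pB0 : (0 < p - 1)%R by rewrite subr_gt0.
pose q := (p / (p - 1))%R.
have q0 : (0 < q)%R by rewrite divr_gt0.
have pq : (q^-1 + p^-1 = 1)%R.
  by rewrite /q invf_div; field; rewrite pN0.
have mWr (r : R) : measurable_fun setT (fun x => W x `^ r)%R.
  exact: (measurableT_comp (measurable_powR r) mW).
have := @hoelder _ _ _ mu (fun x => W x `^ q^-1)%R
  (fun x => W x `^ p^-1 * K x)%R q p (mWr _) (measurable_funM (mWr _) mK) q0 p0 pq.
have -> : Lnorm mu 1 (EFin \o ((fun x => W x `^ q^-1) \*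
    (fun x => W x `^ p^-1 * K x))%R) = \int[mu]_x (W x * K x)%:E.
  rewrite Lnorm1; apply: eq_integral => x _ /=.
  rewrite mulrA -powRD; last by rewrite pq oner_eq0.
  by rewrite pq powRr1// ger0_norm// mulr_ge0.
have -> : Lnorm mu q%:E (EFin \o (fun x => W x `^ q^-1)%R) =
    (\int[mu]_x (W x)%:E) `^ q^-1.
  rewrite unlock; congr (_ `^ _); apply: eq_integral => x _ /=.
  by rewrite ger0_norm ?powR_ge0// -powRrM mulVf ?gt_eqF// powRr1.
have -> : Lnorm mu p%:E (EFin \o (fun x => W x `^ p^-1 * K x)%R) =
    (\int[mu]_x (W x * K x `^ p)%:E) `^ p^-1.
  rewrite unlock; congr (_ `^ _); apply: eq_integral => x _ /=.
  rewrite ger0_norm ?mulr_ge0 ?powR_ge0//.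
  by rewrite powRM ?powR_ge0// -powRrM mulVf// powRr1.
have A0 : 0 <= \int[mu]_x (W x)%:E.
  by apply: integral_ge0 => x _; rewrite lee_fin.
have B0 : 0 <= \int[mu]_x (W x * K x `^ p)%:E.
  by apply: integral_ge0 => x _; rewrite lee_fin mulr_ge0// powR_ge0.
have C0 : 0 <= \int[mu]_x (W x * K x)%:E.
  by apply: integral_ge0 => x _; rewrite lee_fin mulr_ge0.
move: A0 B0 C0; move: (\int[mu]_x _) => A; move: (\int[mu]_x _) => B.
move: (\int[mu]_x _) => C A0 B0 C0 CAB.
have := ge0_le_poweR (ltW p0) C0 CAB.
rewrite poweRM ?poweR_ge0// -!poweRrM mulVf// (poweRe1 B0).
by rewrite [(q^-1 * p)%R](_ : _ = p - 1)%R// /q invf_div mulfVK.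
Qed.

(** The generalized Young inequality: a superposition with weights [W] of
    functions of [L^p] norm at most [D ^ (1/p)]. *)
Lemma Lp_superposition (mu nu : {sigma_finite_measure set T -> \bar R}) (p : R)
    (W : T -> R) (K : T * T -> R) (D : \bar R) :
  (1 <= p)%R -> measurable_fun setT W -> measurable_fun setT K ->
  (forall x, 0 <= W x)%R -> (forall z, 0 <= K z)%R ->
  \int[mu]_x (W x)%:E < +oo -> 0 <= D ->
  (forall x, \int[nu]_y (K (x, y) `^ p)%:E <= D) ->
  \int[nu]_y (\int[mu]_x (W x * K (x, y))%:E) `^ p <=
  (\int[mu]_x (W x)%:E) `^ p * D.
Proof.
move=> p1 mW mK W0 K0 Woo D0 KD.
have mKp : measurable_fun setT (fun z => K z `^ p)%R.
  exact: (measurableT_comp (measurable_powR p) mK).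
have mWK (H : T * T -> R) : measurable_fun setT H ->
    measurable_fun setT (fun z => (W z.1 * H z)%:E).
  move=> mH; apply/measurable_EFinP; apply: measurable_funM => //.
  exact: (measurableT_comp mW measurable_fst).
have A0 : 0 <= \int[mu]_x (W x)%:E.
  by apply: integral_ge0 => x _; rewrite lee_fin.
have Kp0 x y : 0 <= (W x * K (x, y) `^ p)%:E.
  by rewrite lee_fin mulr_ge0// powR_ge0.
have mG (H : T * T -> R) : measurable_fun setT H -> (forall z, 0 <= H z)%R ->
    measurable_fun setT (fun y => \int[mu]_x (W x * H (x, y))%:E).
  move=> mH H0; apply: (measurable_fun_fubini_tonelli_G (m1 := mu)
    (fun z => (W z.1 * H z)%:E)); first exact: mWK.
  by move=> z; rewrite lee_fin mulr_ge0.
have mGp : measurable_fun setT (fun y => \int[mu]_x (W x * K (x, y) `^ p)%:E).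
  by apply: (mG (fun z => K z `^ p)%R) => // z; exact: powR_ge0.
apply: (@le_trans _ _ (\int[nu]_y ((\int[mu]_x (W x)%:E) `^ (p - 1) *
    \int[mu]_x (W x * K (x, y) `^ p)%:E))).
  apply: ge0_le_integralT => [y|||y].
  - exact: poweR_ge0.
  - apply: (measurableT_comp (measurable_poweR p)); exact: mG.
  - by apply: emeasurable_funM; [exact: measurable_cst|exact: mGp].
  - apply: (@weighted_jensen mu p W (fun x => K (x, y))) => //.
    exact: (measurableT_comp mK (measurable_pair2 y)).
rewrite ge0_integralZl ?poweR_ge0//; last first.
  by move=> y _; apply: integral_ge0 => x _; exact: Kp0.
have -> : \int[nu]_y \int[mu]_x (W x * K (x, y) `^ p)%:E =
    \int[mu]_x \int[nu]_y (W x * K (x, y) `^ p)%:E.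
  symmetry.
  apply: (fubini_tonelli (m1 := mu) (m2 := nu) (fun z => (W z.1 * K z `^ p)%:E)).
    exact: (mWK (fun z => K z `^ p)%R).
  by move=> [x y]; exact: Kp0.
have -> : (\int[mu]_x (W x)%:E) `^ p * D =
    (\int[mu]_x (W x)%:E) `^ (p - 1) * \int[mu]_x ((W x)%:E * D).
  rewrite ge0_integralZr//; [|exact/measurable_EFinP|by move=> x _; rewrite lee_fin].
  rewrite muleA; congr (_ * _).
  have Afin : \int[mu]_x (W x)%:E \is a fin_num by rewrite ge0_fin_numE.
  rewrite -(fineK Afin) !poweR_EFin -EFinM mulrC mulr_powRB1//; first exact: fine_ge0.
  by rewrite (lt_le_trans ltr01).
rewrite lee_wpmul2l ?poweR_ge0//.
apply: ge0_le_integralT => [x|||x].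
- by apply: integral_ge0 => y _; exact: Kp0.
- apply: (measurable_fun_fubini_tonelli_F (m2 := nu)
    (fun z => (W z.1 * K z `^ p)%:E)); first exact: (mWK (fun z => K z `^ p)%R).
  by move=> [x y]; exact: Kp0.
- by apply: emeasurable_funM; [exact/measurable_EFinP|exact: measurable_cst].
- under eq_integral do rewrite EFinM.
  rewrite ge0_integralZl ?lee_fin//.
  + by rewrite lee_wpmul2l ?lee_fin.
  + apply/measurable_EFinP; exact: (measurableT_comp mKp (measurable_pair1 x)).
  + by move=> y _; rewrite lee_fin powR_ge0.
Qed.

End kernel_operator.

(** * Schwartz windows and tempered functions *)

Section schwartz_windows.
Variables (R : realType) (n : nat).
Implicit Types (k m l : lattice n) (w v : torus R n) (f g h : lattice n -> R[i]).
Local Open Scope classical_set_scope.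
Local Notation count := (count_measure R n).
Local Notation nrm := (lattice_norm R).

Definition windowed g f m : lattice n -> R[i] :=
  fun k => f k * (g (k - m))^*.

Definition polynomially_bounded f : Prop :=
  exists (N : nat) (C : R), forall k, cabs (f k) <= C * (1 + nrm k) ^+ N.

Lemma weight_ge1 k (N : nat) : 1 <= (1 + nrm k) ^+ N.
Proof. by rewrite exprn_ege1// lerDl lattice_norm_ge0. Qed.

(** [n + 2] powers of the weight are given up for summability. *)
Lemma schwartz_summable g (N : nat) : schwartz g ->
  (\int[count]_k ((1 + nrm k) ^+ N * cabs (g k))%:E < +oo)%E.
Proof.
move=> /(_ (N + n.+2)%N)[C gC].
have C0 : 0 <= C.
  apply: le_trans (gC 0); rewrite mulr_ge0 ?cabs_ge0//.
  exact: le_trans ler01 (weight_ge1 0 _).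
apply: (@le_lt_trans _ _ (\int[count]_k (C%:E * ((1 + nrm k) ^- n.+2)%:E))%E).
  apply: ge0_le_integralT => // k.
    by rewrite lee_fin mulr_ge0 ?cabs_ge0//; exact: le_trans ler01 (weight_ge1 k _).
  rewrite -EFinM lee_fin ler_pdivlMr; last first.
    exact: lt_le_trans ltr01 (weight_ge1 k _).
  by rewrite mulrAC -exprD.
have w0 k : (0 <= ((1 + nrm k) ^- n.+2)%:E)%E.
  by rewrite lee_fin invr_ge0; exact: le_trans ler01 (weight_ge1 k _).
rewrite ge0_integralZl//.
have s0 : (0 <= \int[count]_k ((1 + nrm k) ^- n.+2)%:E)%E by exact: integral_ge0.
by rewrite lte_mul_pinfty//; exact: summable_lattice_weight.
Qed.

Lemma cintegrable_windowed_schwartz g f m : schwartz g ->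
  polynomially_bounded f -> cintegrable count (windowed g f m).
Proof.
move=> gS [N [C fC]].
have C0 : 0 <= C.
  have := le_trans (cabs_ge0 _) (fC 0).
  by rewrite pmulr_lge0//; exact: lt_le_trans ltr01 (weight_ge1 0 _).
pose D := C * (2 * (1 + nrm m)) ^+ N.
have D0 : 0 <= D.
  by rewrite mulr_ge0// exprn_ge0// mulr_ge0// addr_ge0// lattice_norm_ge0.
apply: (@cintegrable_count_bound _ _ _
    (fun k => D * ((1 + nrm (k - m)) ^+ N * cabs (g (k - m))))) => [k|].
  rewrite cabsM cabs_conj mulrA ler_wpM2r ?cabs_ge0// (le_trans (fC k))//.
  rewrite /D -mulrA ler_wpM2l// -exprMn lerXn2r ?nnegrE//.
  - by rewrite addr_ge0// lattice_norm_ge0.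
  - by rewrite !mulr_ge0// addr_ge0// lattice_norm_ge0.
  - by rewrite -mulrA; exact: lattice_norm_shift.
pose F k := (1 + nrm k) ^+ N * cabs (g k).
have F0 k : (0 <= (F k)%:E)%E.
  by rewrite lee_fin mulr_ge0 ?cabs_ge0//; exact: le_trans ler01 (weight_ge1 k _).
under eq_integral do rewrite EFinM.
rewrite (integral_count_bij (h := fun k => (D%:E * (F k)%:E)%E) (bijective_subr m)); last first.
  by move=> k; rewrite mule_ge0// lee_fin.
rewrite ge0_integralZl ?lee_fin//.
have s0 : (0 <= \int[count]_k (F k)%:E)%E by exact: integral_ge0.
by rewrite lte_mul_pinfty//; exact: schwartz_summable.
Qed.

Lemma schwartz_delta m : schwartz (delta R m).
Proof.
move=> N; exists ((1 + nrm m) ^+ N) => k; rewrite /delta.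
have [->|_] := eqVneq k m; first by rewrite cabs1 mulr1.
by rewrite cabs0 mulr0; exact: le_trans ler01 (weight_ge1 m _).
Qed.

(** Test the functional on [delta k], whose seminorm of order [N] is the
    weight at [k]. *)
Lemma tempered_polynomially_bounded f : tempered f -> polynomially_bounded f.
Proof.
move=> [u [[_ [N [C uC]]] uf]]; exists N, `|C| => k.
rewrite -uf (le_trans (uC _ (schwartz_delta k)))//.
rewrite (le_trans (ler_norm _))// normrM ler_wpM2l//.
rewrite /schwartz_seminorm; set A := (X in sup X).
have A0 : A !=set0 by exists ((1 + nrm k) ^+ N * cabs (delta R k k)), k.
have Aub : ubound A ((1 + nrm k) ^+ N).
  move=> _ [j _ <-]; rewrite /delta.
  have [->|_] := eqVneq j k; first by rewrite cabs1 mulr1.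
  by rewrite cabs0 mulr0; exact: le_trans ler01 (weight_ge1 k _).
rewrite ger0_norm; first exact: ge_sup.
apply: (@le_trans _ _ ((1 + nrm k) ^+ N * cabs (delta R k k))).
  by rewrite mulr_ge0 ?cabs_ge0//; exact: le_trans ler01 (weight_ge1 k _).
apply: ub_le_sup; last by exists k.
by exists ((1 + nrm k) ^+ N).
Qed.

Lemma bounded_polynomially_bounded f (C : R) :
  (forall k, cabs (f k) <= C) -> polynomially_bounded f.
Proof. by move=> fC; exists 0%N, C => k; rewrite expr0 mulr1. Qed.

(** A bounded function acts on the Schwartz space by summation. *)
Lemma bounded_tempered f (C : R) : (forall k, cabs (f k) <= C) -> tempered f.
Proof.
move=> fC; have C0 : 0 <= C := le_trans (cabs_ge0 _) (fC 0).
pose u phi := cintegral count (fun k => f k * phi k).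
have iphi phi : schwartz phi -> cintegrable count (fun k => f k * phi k).
  move=> sphi; apply: (@cintegrable_count_bound _ _ _
      (fun k => C * ((1 + nrm k) ^+ 0 * cabs (phi k)))) => [k|].
    by rewrite expr0 mul1r cabsM ler_wpM2r ?cabs_ge0.
  under eq_integral do rewrite EFinM.
  have F0 k : (0 <= ((1 + nrm k) ^+ 0 * cabs (phi k))%:E)%E.
    by rewrite lee_fin expr0 mul1r cabs_ge0.
  rewrite ge0_integralZl ?lee_fin//.
  have s0 : (0 <= \int[count]_k ((1 + nrm k) ^+ 0 * cabs (phi k))%:E)%E.
    exact: integral_ge0.
  by rewrite lte_mul_pinfty//; exact: schwartz_summable.
exists u; split; last first.
  move=> k; rewrite /u (@cintegral_count_supp1 _ _ _ k) /delta ?eqxx ?mulr1//.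
  by move=> j /negPf ->; rewrite mulr0.
split.
  move=> a phi psi sphi spsi; rewrite /u -cintegralZl; last exact: iphi.
  rewrite -cintegralD; [|exact/cintegrableZl/iphi|exact: iphi].
  by apply: eq_cintegral => k; ring.
pose S := fine (\int[count]_k ((1 + nrm k) ^- n.+2)%:E).
have w0 k : (0 <= ((1 + nrm k) ^- n.+2)%:E)%E.
  by rewrite lee_fin invr_ge0; exact: le_trans ler01 (weight_ge1 k _).
have SE : (\int[count]_k ((1 + nrm k) ^- n.+2)%:E)%E = S%:E.
  by rewrite fineK// ge0_fin_numE ?integral_ge0//; exact: summable_lattice_weight.
exists n.+2, (C * S) => phi sphi.
set q := schwartz_seminorm _ _.
have phiq k : (1 + nrm k) ^+ n.+2 * cabs (phi k) <= q.
  apply: ub_le_sup; last by exists k.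
  by have [D phiD] := sphi n.+2; exists D => _ [j _ <-].
have q0 : 0 <= q.
  apply: le_trans (phiq 0); rewrite mulr_ge0 ?cabs_ge0//.
  exact: le_trans ler01 (weight_ge1 0 _).
rewrite -lee_fin (le_trans (cabs_cintegral_le (iphi _ sphi)))//.
apply: (@le_trans _ _ (\int[count]_k ((C * q)%:E * ((1 + nrm k) ^- n.+2)%:E))%E).
  apply: ge0_le_integralT => // k; first by rewrite lee_fin cabs_ge0.
  rewrite -EFinM lee_fin cabsM -mulrA ler_pM ?cabs_ge0// ler_pdivlMr.
    by rewrite mulrC.
  exact: lt_le_trans ltr01 (weight_ge1 k _).
rewrite ge0_integralZl ?lee_fin ?mulr_ge0//.
by rewrite SE -EFinM lee_fin mulrAC.
Qed.

End schwartz_windows.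

(** * Embedding of modulation spaces into square-summable functions *)

Section modulation_embedding.
Variables (R : realType) (n : nat).
Implicit Types (k m l : lattice n) (w v : torus R n) (f g h : lattice n -> R[i])
  (z : lattice n * torus R n).
Local Open Scope classical_set_scope.
Local Notation count := (count_measure R n).
Local Notation tf := (tf_measure R n).

(** The slices of the short-time Fourier transform are Fourier series; this
    brings the theory of the previous parts to bear on it. *)
Lemma stftE g f z : stft g f z = fourier (windowed g f z.1) z.2.
Proof.
apply: eq_cintegral => k; rewrite /modul /transl /windowed conjCM.
by rewrite mulrA [in RHS]mulrAC.
Qed.

Lemma cmeasurable_stft g f :
  (forall m, cintegrable count (windowed g f m)) -> cmeasurable (stft g f).
Proof.
move=> iw; apply: cmeasurable_lattice_prod => m.
have -> : (fun w => stft g f (m, w)) = fourier (windowed g f m).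
  by apply/funext => w; rewrite stftE.
exact: cmeasurable_fourier.
Qed.

Lemma integral_tf (H : lattice n * torus R n -> \bar R) :
  measurable_fun setT H -> (forall z, (0 <= H z)%E) ->
  (\int[tf]_z H z = \int[count]_m \int[haar R n]_w H (m, w))%E.
Proof.
move=> mH H0.
exact: (fubini_tonelli1 (m1 := count_sigma_finite R n) (m2 := haar R n) H mH H0).
Qed.

Definition sqsum f : \bar R := (\int[count]_k (cabs (f k) ^+ 2)%:E)%E.

Lemma sqsum_ge0 f : (0 <= sqsum f)%E.
Proof. by apply: integral_ge0 => k _; rewrite lee_fin sqr_ge0. Qed.

Lemma ell_norm2E f : ell_norm 2%:E f = (sqsum f `^ 2^-1)%E.
Proof.
rewrite /ell_norm cLnormE; congr (_ `^ _)%E; apply: eq_integral => k _.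
by rewrite powR_mulrn// cabs_ge0.
Qed.

Lemma ell_norm_ge0 f : (0 <= ell_norm 2%:E f)%E.
Proof. by rewrite ell_norm2E poweR_ge0. Qed.

Lemma sqr_ell_norm2 f : (ell_norm 2%:E f `^ 2 = sqsum f)%E.
Proof. by rewrite ell_norm2E -poweRrM mulVf// poweRe1// sqsum_ge0. Qed.

Lemma ell_norm2_fin_num f : (sqsum f < +oo)%E -> ell_norm 2%:E f \is a fin_num.
Proof.
by move=> foo; rewrite ge0_fin_numE ?ell_norm_ge0// ell_norm2E poweR_lty.
Qed.

Lemma in_ell2_sqsum f : in_ell 2%:E f -> (sqsum f < +oo)%E.
Proof.
move=> [_ _]; rewrite -/(ell_norm 2%:E f) ell_norm2E; apply: lty_poweRy.
by rewrite invr_neq0.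
Qed.

Lemma sqsum_translate f m : sqsum (fun k => f (k - m)) = sqsum f.
Proof.
apply: (integral_count_bij (h := fun k => (cabs (f k) ^+ 2)%:E)).
  exact: bijective_subr.
by move=> k; rewrite lee_fin sqr_ge0.
Qed.

Lemma cauchy_schwarz_windowed g f m :
  (\int[count]_k (cabs (windowed g f m k))%:E <=
   ell_norm 2%:E f * ell_norm 2%:E g)%E.
Proof.
pose gm k := g (k - m).
have -> : ell_norm 2%:E g = ell_norm 2%:E gm.
  by rewrite !ell_norm2E /gm sqsum_translate.
have := @hoelder _ _ _ count (fun k => cabs (f k)) (fun k => cabs (gm k)) 2 2.
have m0 h : measurable_fun setT (fun k => cabs (h k)).
  exact: measurable_fun_lattice.
move=> /(_ (m0 _) (m0 _) (ltr0Sn _ _) (ltr0Sn _ _)).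
have -> : (2^-1 + 2^-1 = 1 :> R) by field.
move=> /(_ erefl); apply: le_trans; rewrite Lnorm1 le_eqVlt; apply/orP; left.
apply/eqP; apply: eq_integral => k _ /=.
by rewrite cabsM cabs_conj ger0_norm// mulr_ge0// cabs_ge0.
Qed.

Lemma cintegrable_windowed_ell2 g f m :
  (sqsum f < +oo)%E -> (sqsum g < +oo)%E -> cintegrable count (windowed g f m).
Proof.
move=> foo goo; split; first exact: cmeasurable_lattice.
apply: le_lt_trans (cauchy_schwarz_windowed _ _ _) _.
rewrite -(fineK (ell_norm2_fin_num foo)) -(fineK (ell_norm2_fin_num goo)).
by rewrite -EFinM ltry.
Qed.

Lemma stft_le g f z : (sqsum f < +oo)%E -> (sqsum g < +oo)%E ->
  ((cabs (stft g f z))%:E <= ell_norm 2%:E f * ell_norm 2%:E g)%E.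
Proof.
move=> foo goo; rewrite stftE; apply: le_trans (cauchy_schwarz_windowed _ _ z.1).
by apply: fourier_le; exact: cintegrable_windowed_ell2.
Qed.

(** Moyal's identity: Parseval in the frequency variable, then summation over
    the position of the window. *)
Lemma integral_sqr_stft g f :
  (forall m, cintegrable count (windowed g f m)) ->
  (\int[tf]_z (cabs (stft g f z) ^+ 2)%:E = sqsum f * sqsum g)%E.
Proof.
move=> iw; have mV := cmeasurable_stft iw.
rewrite integral_tf; last by move=> z; rewrite lee_fin sqr_ge0.
  2: by apply/measurable_EFinP; apply: measurable_funX; exact: cmeasurable_cabs.
transitivity (\int[count]_m \int[count]_k
    (cabs (f k) ^+ 2 * cabs (g (k - m)) ^+ 2)%:E)%E.
  apply: eq_integral => m _.
  transitivity (\int[haar R n]_w (cabs (fourier (windowed g f m) w) ^+ 2)%:E)%E.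
    by apply: eq_integral => w _; rewrite stftE.
  rewrite parseval; last exact: iw.
  by apply: eq_integral => k _; rewrite cabsM cabs_conj exprMn.
have fub := fubini_tonelli (m1 := count_sigma_finite R n)
  (m2 := count_sigma_finite R n)
  (fun z : lattice n * lattice n => (cabs (f z.2) ^+ 2 * cabs (g (z.2 - z.1)) ^+ 2)%:E).
transitivity (\int[count]_k \int[count]_m
    (cabs (f k) ^+ 2 * cabs (g (k - m)) ^+ 2)%:E)%E.
  apply: fub; last by move=> z; rewrite lee_fin mulr_ge0// sqr_ge0.
  by apply: measurable_fun_lattice_prod => m; exact: measurable_fun_lattice.
have g0 h k : (0 <= (cabs (h k) ^+ 2)%:E)%E by rewrite lee_fin sqr_ge0.
transitivity (\int[count]_k ((cabs (f k) ^+ 2)%:E * sqsum g))%E; last first.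
  apply: ge0_integralZr; [exact: measurableT|exact: measurable_fun_lattice|
    by move=> k _; exact: g0|exact: sqsum_ge0].
apply: eq_integral => k _.
transitivity (\int[count]_m ((cabs (f k) ^+ 2)%:E * (cabs (g (k - m)) ^+ 2)%:E))%E.
  by apply: eq_integral => m _; rewrite EFinM.
rewrite (integral_count_bij (f := fun m => k - m)
  (h := fun m => ((cabs (f k) ^+ 2)%:E * (cabs (g m) ^+ 2)%:E)%E)).
- by rewrite ge0_integralZl// lee_fin sqr_ge0.
- exact: bijective_rsub.
- by move=> m; rewrite mule_ge0// lee_fin sqr_ge0.
Qed.

Lemma modulation_normE g p f :
  modulation_norm g p%:E f = ((\int[tf]_z (cabs (stft g f z) `^ p)%:E) `^ p^-1)%E.
Proof. exact: cLnormE. Qed.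

Section embedding.
Variables (g f : lattice n -> R[i]) (p : R).
Hypotheses (gS : schwartz g) (g_neq0 : exists k, g k != 0) (p12 : 1 <= p <= 2)
  (fM : modulation_space g p%:E f).

Let iw m : cintegrable count (windowed g f m).
Proof.
apply: cintegrable_windowed_schwartz => //.
by apply: tempered_polynomially_bounded; case: fM.
Qed.

Let p1 : 1 <= p. Proof. by case/andP: p12. Qed.
Let p0 : 0 < p. Proof. exact: lt_le_trans ltr01 p1. Qed.

Let mVp : measurable_fun setT (fun z => (cabs (stft g f z) `^ p)%:E).
Proof.
apply/measurable_EFinP; apply: (measurableT_comp (measurable_powR p)).
by apply: cmeasurable_cabs; exact: cmeasurable_stft.
Qed.

Let Voo : (\int[tf]_z (cabs (stft g f z) `^ p)%:E < +oo)%E.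
Proof.
have [_ [_ _]] := fM; rewrite cLnormE; apply: lty_poweRy.
by rewrite invr_neq0// gt_eqF.
Qed.

(** [f k * conj (g (k - m))] is a Fourier coefficient of [stft g f (m, .)],
    so that [|f k|] is controlled by the slice [m = k - k0] with
    [g k0 != 0]. *)
Lemma modulation_ellp : (\int[count]_k (cabs (f k) `^ p)%:E < +oo)%E.
Proof.
have [k0 gk0] := g_neq0.
have c0 : 0 < cabs (g k0) by rewrite lt_neqAle eq_sym cabs_eq0 gk0 cabs_ge0.
have cp0 : 0 < cabs (g k0) `^ p by rewrite powR_gt0.
have slice m : (((cabs (g k0) `^ p)%:E * (cabs (f (m + k0)) `^ p)%:E) <=
    \int[haar R n]_w (cabs (stft g f (m, w)) `^ p)%:E)%E.
  rewrite -EFinM -powRM ?cabs_ge0// mulrC.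
  have -> : cabs (f (m + k0)) * cabs (g k0) = cabs (windowed g f m (m + k0)).
    by rewrite cabsM cabs_conj addrC addrK.
  have mF := cmeasurable_cabs (cmeasurable_fourier (iw m)).
  (* Jensen's inequality on the torus, a probability space *)
  have J := @weighted_jensen _ _ _ (haar R n) p (fun=> 1)
    (fun w => cabs (fourier (windowed g f m) w)) p1 (measurable_cst _) mF
    (fun=> ler01) (fun w => cabs_ge0 _).
  have one : (\int[haar R n]_w 1%:E = 1)%E.
    by rewrite integral_cst// mul1e; exact: probability_setT.
  move: J; rewrite one poweR1r mul1e => J.
  rewrite -poweR_EFin.
  apply: (@le_trans _ _ ((\int[haar R n]_w
      (1 * cabs (fourier (windowed g f m) w))%:E) `^ p)%E).
    apply: ge0_le_poweR; first exact: ltW.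
    - by rewrite lee_fin cabs_ge0.
    - under eq_integral do rewrite mul1r.
      exact: norm_fourier_coef_le.
  apply: (le_trans J); rewrite le_eqVlt; apply/orP; left; apply/eqP.
  by apply: eq_integral => w _; rewrite mul1r stftE.
have f0 k : (0 <= (cabs (f k) `^ p)%:E)%E by rewrite lee_fin powR_ge0.
have le : ((cabs (g k0) `^ p)%:E * \int[count]_k (cabs (f k) `^ p)%:E <=
    \int[tf]_z (cabs (stft g f z) `^ p)%:E)%E.
  rewrite integral_tf//; last by move=> z; rewrite lee_fin powR_ge0.
  rewrite -(integral_count_bij (h := fun k => (cabs (f k) `^ p)%:E)
    (bijective_addr k0))// -ge0_integralZl//; last by rewrite lee_fin ltW.
  by apply: ge0_le_integralT => // m; rewrite mule_ge0// lee_fin ltW.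
rewrite ltNge leye_eq; apply/negP => /eqP foo.
by move: le; rewrite foo gt0_muley ?lte_fin// leye_eq => /eqP Vy; move: Voo; rewrite Vy.
Qed.

Lemma modulation_bounded : exists2 B, 1 <= B & forall k, cabs (f k) <= B.
Proof.
have f0 k : (0 <= (cabs (f k) `^ p)%:E)%E by rewrite lee_fin powR_ge0.
pose S := fine (\int[count]_k (cabs (f k) `^ p)%:E).
have fS k : cabs (f k) `^ p <= S.
  rewrite -lee_fin fineK.
    exact: (le_integral_count (h := fun k => (cabs (f k) `^ p)%:E)).
  by rewrite ge0_fin_numE ?integral_ge0//; exact: modulation_ellp.
have S0 : 0 <= S by exact: le_trans (powR_ge0 _ _) (fS 0).
exists (1 + S) => [|k]; first by rewrite lerDl.
have [f1|f1] := leP (cabs (f k)) 1; first by rewrite (le_trans f1)// lerDl.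
rewrite (le_trans (le1r_powR (ltW f1) p1))// (le_trans (fS k))//.
by rewrite lerDr.
Qed.

(** [f] is bounded and [p <= 2], so that [|f| ^ 2] is dominated by a multiple
    of [|f| ^ p]. *)
Lemma modulation_ell2 : (sqsum f < +oo)%E.
Proof.
have [B B1 fB] := modulation_bounded.
have [_ p2] := andP p12.
have f0 k : (0 <= (cabs (f k) `^ p)%:E)%E by rewrite lee_fin powR_ge0.
apply: (@le_lt_trans _ _ ((B `^ (2 - p))%:E *
    \int[count]_k (cabs (f k) `^ p)%:E)%E).
  rewrite -ge0_integralZl ?lee_fin ?powR_ge0//.
  apply: ge0_le_integralT => // k; first by rewrite lee_fin sqr_ge0.
  rewrite -EFinM lee_fin -powR_mulrn ?cabs_ge0//.
  rewrite -[X in _ `^ X <= _](subrK p) powRD ?subrK ?pnatr_eq0//.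
  rewrite ler_wpM2r ?powR_ge0// ge0_ler_powR ?nnegrE ?cabs_ge0 ?subr_ge0//.
  exact: le_trans ler01 B1.
rewrite lte_mul_pinfty ?lee_fin ?powR_ge0//; first exact: modulation_ellp.
Qed.

(** Moyal's identity and [|stft g f| <= A], with [A] the product of the
    [l^2] norms, give [A ^ 2 <= A ^ (2 - p) * (norm of f) ^ p]. *)
Lemma ell2_le_modulation_norm : (sqsum g < +oo)%E ->
  (ell_norm 2%:E f * ell_norm 2%:E g <= modulation_norm g p%:E f)%E.
Proof.
move=> goo; have foo := modulation_ell2; have [_ p2] := andP p12.
have ffin := ell_norm2_fin_num foo; have gfin := ell_norm2_fin_num goo.
have VA z := stft_le z foo goo.
have VA2 := integral_sqr_stft iw.
rewrite -!sqr_ell_norm2 in VA2.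
pose A := fine (ell_norm 2%:E f * ell_norm 2%:E g)%E.
have AE : (ell_norm 2%:E f * ell_norm 2%:E g)%E = A%:E by rewrite fineK// fin_numM.
have A0 : 0 <= A by rewrite fine_ge0// mule_ge0// ell_norm_ge0.
rewrite AE in VA *.
rewrite -poweRM ?ell_norm_ge0// AE poweR_EFin in VA2.
have N0 : (0 <= \int[tf]_z (cabs (stft g f z) `^ p)%:E)%E.
  by apply: integral_ge0 => z _; rewrite lee_fin powR_ge0.
pose N := fine (\int[tf]_z (cabs (stft g f z) `^ p)%:E)%E.
have NE : (\int[tf]_z (cabs (stft g f z) `^ p)%:E)%E = N%:E.
  by rewrite fineK// ge0_fin_numE.
have N0' : 0 <= N by rewrite fine_ge0.
have : ((A `^ 2)%:E <= (A `^ (2 - p))%:E * N%:E)%E.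
  rewrite -VA2 -NE -ge0_integralZl ?lee_fin ?powR_ge0//; last first.
    by move=> z _; rewrite lee_fin powR_ge0.
  apply: ge0_le_integralT => [z|||z].
  - by rewrite lee_fin sqr_ge0.
  - apply/measurable_EFinP; apply: measurable_funX; apply: cmeasurable_cabs.
    exact: cmeasurable_stft.
  - exact: measurable_funeM.
  rewrite -EFinM lee_fin -powR_mulrn ?cabs_ge0//.
  rewrite -[X in _ `^ X <= _](subrK p) powRD ?subrK ?pnatr_eq0//.
  rewrite ler_wpM2r ?powR_ge0// ge0_ler_powR ?nnegrE ?cabs_ge0 ?subr_ge0//.
  by rewrite -lee_fin.
rewrite -EFinM lee_fin => AN.
have ApN : A `^ p <= N.
  have [->|An0] := eqVneq A 0; first by rewrite powR0// gt_eqF.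
  have A2p : 0 < A `^ (2 - p) by rewrite powR_gt0// lt_neqAle eq_sym An0.
  rewrite -(ler_pM2l A2p) -powRD ?subrK// An0 implybT//.
rewrite modulation_normE NE poweR_EFin lee_fin.
have -> : A = (A `^ p) `^ p^-1.
  by rewrite -powRrM mulfV ?gt_eqF// powRr1.
by rewrite ge0_ler_powR ?nnegrE ?powR_ge0 ?invr_ge0// ltW.
Qed.

End embedding.

End modulation_embedding.

(** * Superpositions of time-frequency shifts *)

Section superposition.
Variables (R : realType) (n : nat).
Implicit Types (k m l : lattice n) (w v : torus R n) (f g h : lattice n -> R[i])
  (z : lattice n * torus R n).
Local Open Scope classical_set_scope.
Local Notation count := (count_measure R n).
Local Notation tf := (tf_measure R n).

Lemma sigma_finite_tf : sigma_finite setT tf.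
Proof.
have [F TF Foo] := sigma_finite_count R n.
exists (fun i => F i `*` setT).
  by rewrite -setX_bigcupl -TF setXTT.
move=> i; have [mF Fi] := Foo i; split; first exact: measurableX.
rewrite [X in (X < _)%E](_ : _ = count (F i) * haar R n setT)%E; last first.
  by apply: product_measure1E.
by rewrite [X in (_ * X)%E](_ : _ = 1%E) ?mule1//; exact: probability_setT.
Qed.

(** The measure of the time-frequency plane under a name that carries its
    sigma-finiteness. *)
Definition tf_sigma_finite_fun : set (lattice n * torus R n)%type -> \bar R := tf.
HB.instance Definition _ := Measure.copy tf_sigma_finite_fun tf.
HB.instance Definition _ := Measure_isSigmaFinite.Build _ _ _
  tf_sigma_finite_fun sigma_finite_tf.
Definition tf_sigma_finite :
  {sigma_finite_measure set (lattice n * torus R n)%type -> \bar R} :=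
  tf_sigma_finite_fun.

Definition time_frequency_shift z h : lattice n -> R[i] :=
  modul z.2 (transl z.1 h).

Lemma cabs_time_frequency_shift z h k :
  cabs (time_frequency_shift z h k) = cabs (h (k - z.1)).
Proof. by rewrite cabsM cabs_cis mul1r. Qed.

Lemma cmeasurable_time_frequency_shift h k :
  cmeasurable (fun z => time_frequency_shift z h k).
Proof.
apply: cmeasurable_lattice_prod => m.
apply: (cmeasurableM (F := fun w => cis (dot w k)) (G := fun=> h (k - m))).
  exact: cmeasurable_character.
exact: cmeasurable_cst.
Qed.

Definition tf_sub z' z : lattice n * torus R n :=
  (z'.1 - z.1, torus_sub z'.2 z.2).

Lemma measurable_tf_sub :
  measurable_fun setT (fun q : (lattice n * torus R n) * (lattice n * torus R n) =>
    tf_sub q.2 q.1).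
Proof.
have m1 : measurable_fun setT
    (fun q : (lattice n * torus R n) * (lattice n * torus R n) => q.1).
  exact: measurable_fst.
have m2 : measurable_fun setT
    (fun q : (lattice n * torus R n) * (lattice n * torus R n) => q.2).
  exact: measurable_snd.
apply/measurable_fun_pairP; split.
  pose sub (q : lattice n * lattice n) : lattice n := q.2 - q.1.
  have msub : measurable_fun setT sub.
    by apply: measurable_fun_lattice_prod => m; exact: measurable_fun_lattice.
  have mpair : measurable_fun setT
      (fun q : (lattice n * torus R n) * (lattice n * torus R n) => (q.1.1, q.2.1)).
    apply/measurable_fun_pairP; split.
      exact: (measurableT_comp measurable_fst m1).
    exact: (measurableT_comp measurable_fst m2).
  exact: (measurableT_comp msub mpair).
apply: measurable_torus_sub.
  exact: (measurableT_comp measurable_snd m2).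
exact: (measurableT_comp measurable_snd m1).
Qed.

(** Covariance of the short-time Fourier transform: up to a phase, shifting the
    signal in the time-frequency plane translates its transform. *)
Lemma cabs_stft_shift g h z z' :
  (forall m, cintegrable count (windowed g h m)) ->
  cabs (stft g (time_frequency_shift z h) z') = cabs (stft g h (tf_sub z' z)).
Proof.
move=> iw; case: z z' => [m w] [m' w'].
pose F k := windowed g h (m' - m) k * (cis (dot (torus_sub w' w) k))^*.
have iF : cintegrable count F by exact: cintegrable_fourier.
(* the phase relating the two transforms *)
pose c := cis (dot w m) * (cis (dot w' m))^*.
have -> : stft g (time_frequency_shift (m, w) h) (m', w') =
    cintegral count (fun k => c * F (k - m)).
  apply: eq_cintegral => k; rewrite /F /c /windowed /time_frequency_shift.
  rewrite /modul /transl [(m, w).1]/= [(m, w).2]/= [(m', w').1]/= [(m', w').2]/=.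
  rewrite dot_sub !dotD !dotN.
  have -> : k - m - (m' - m) = k - m' by rewrite opprB addrA subrK.
  rewrite conjCM.
  have -> : (dot w' k - dot w' m - (dot w k - dot w m)) =
      dot w' k + (- dot w' m + (- dot w k + dot w m)) by ring.
  rewrite !cisD !cisN !conjCM !conjCK.
  have e1 : cis (dot w m) * (cis (dot w m))^* = 1 :> R[i].
    by rewrite mul_conj cabs_cis expr1n.
  have e2 : cis (dot w' m) * (cis (dot w' m))^* = 1 :> R[i].
    by rewrite mul_conj cabs_cis expr1n.
  move: (cis (dot w m)) (cis (dot w' m)) (cis (dot w k)) (cis (dot w' k)) e1 e2.
  move=> a b x y e1 e2.
  transitivity (x * h (k - m) * (y^* * (g (k - m'))^*) *
    (a * a^*) * (b * b^*)); first by rewrite e1 e2 !mulr1.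
  by ring.
rewrite cintegralZl; last first.
  split; first exact: cmeasurable_lattice.
  have [_] := iF; apply: le_lt_trans; rewrite le_eqVlt; apply/orP; left; apply/eqP.
  apply: (integral_count_bij (h := fun k => (cabs (F k))%:E)).
    exact: bijective_subr.
  by move=> k; rewrite lee_fin cabs_ge0.
rewrite (cintegral_count_bij (bijective_subr m) iF).
by rewrite cabsM /c cabsM cabs_conj !cabs_cis !mul1r stftE.
Qed.

(** Invariance under translation of both factors; in the frequency variable
    it relies on the periodicity of the slices. *)
Lemma integral_tf_translation g h (p : R) z :
  (forall m, cintegrable count (windowed g h m)) ->
  (\int[tf]_z' (cabs (stft g h (tf_sub z' z)) `^ p)%:E =
   \int[tf]_z' (cabs (stft g h z') `^ p)%:E)%E.
Proof.
move=> iw.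
have mV : measurable_fun setT (fun z => (cabs (stft g h z) `^ p)%:E).
  apply/measurable_EFinP; apply: (measurableT_comp (measurable_powR p)).
  by apply: cmeasurable_cabs; exact: cmeasurable_stft.
have V0 z' : (0 <= (cabs (stft g h z') `^ p)%:E)%E by rewrite lee_fin powR_ge0.
have msub : measurable_fun setT (fun z' => tf_sub z' z).
  exact: (measurableT_comp measurable_tf_sub (measurable_pair1 z)).
pose H z' := (cabs (stft g h z') `^ p)%:E.
have mHz : measurable_fun setT (fun z' => H (tf_sub z' z)).
  exact: (measurableT_comp mV msub).
have E1 := integral_tf mHz (fun z' => V0 _).
have E2 := integral_tf mV V0.
apply: (etrans E1); apply: (etrans _ (esym E2)).
pose Phi m := (\int[haar R n]_w H (m, w))%E.
transitivity (\int[count]_m Phi (m - z.1)%R)%E; last first.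
  apply: (integral_count_bij (h := Phi) (bijective_subr z.1)) => m.
  by apply: integral_ge0 => w _; exact: V0.
apply: eq_integral => m _.
apply: (haar_translation (F := fun w => H (m - z.1, w)) z.2).
- exact: (measurableT_comp mV (measurable_pair1 _)).
- by move=> w; exact: V0.
- move=> w v vj; rewrite /H !stftE.
  by rewrite (@fourier_torus_periodic R n (windowed g h (m - z.1)) w v vj).
Qed.

Lemma cintegrableMr d (T : measurableType d) (mu : {measure set T -> \bar R})
    (F G : T -> R[i]) (C : R) :
  cintegrable mu F -> cmeasurable G -> (forall x, cabs (G x) <= C) ->
  cintegrable mu (fun x => F x * G x).
Proof.
move=> iF mG GC; apply: (le_cintegrable (h := fun x => cabs (F x) * C)).
- by apply: cmeasurableM => //; exact: iF.1.
- apply: measurable_funM; last exact: measurable_cst.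
  exact: cmeasurable_cabs iF.1.
- by move=> x; rewrite cabsM ler_wpM2l ?cabs_ge0.
- exact: integral_cabsMr_lty.
Qed.

Section synthesis.
Variables (g h : lattice n -> R[i]) (W : lattice n * torus R n -> R[i]) (C : R).
Hypotheses (gS : schwartz g) (iW : cintegrable tf W) (hC : forall k, cabs (h k) <= C).

(** The superposition of the time-frequency shifts of [h] with weights [W]: the
    operator formally adjoint to the short-time Fourier transform with window
    [h]. *)
Definition synthesis k : R[i] :=
  cintegral tf (fun z => W z * time_frequency_shift z h k).

Lemma cintegrable_synthesis k :
  cintegrable tf (fun z => W z * time_frequency_shift z h k).
Proof.
apply: (cintegrableMr (C := C)) => //; first exact: cmeasurable_time_frequency_shift.
by move=> z; rewrite cabs_time_frequency_shift.
Qed.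

Lemma synthesis_bounded : exists D, forall k, cabs (synthesis k) <= D.
Proof.
have Woo := integral_cabsMr_lty C iW.
have W0 : (0 <= \int[tf]_z (cabs (W z) * C)%:E)%E.
  apply: integral_ge0 => z _.
  by rewrite lee_fin mulr_ge0 ?cabs_ge0// (le_trans (cabs_ge0 (h 0))).
exists (fine (\int[tf]_z (cabs (W z) * C)%:E)) => k.
rewrite -lee_fin fineK; last by rewrite ge0_fin_numE.
apply: (le_trans (cabs_cintegral_le (cintegrable_synthesis k))).
apply: ge0_le_integralT => [z|||z].
- by rewrite lee_fin cabs_ge0.
- exact: measurable_cabs_EFin (cintegrable_synthesis k).1.
- apply/measurable_EFinP; apply: measurable_funM; last exact: measurable_cst.
  exact: cmeasurable_cabs iW.1.
- by rewrite lee_fin cabsM ler_wpM2l ?cabs_ge0// cabs_time_frequency_shift.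
Qed.

Lemma tempered_synthesis : tempered synthesis.
Proof. by have [D bD] := synthesis_bounded; exact: bounded_tempered bD. Qed.

Lemma cintegrable_windowed_bounded f (D : R) m :
  (forall k, cabs (f k) <= D) -> cintegrable count (windowed g f m).
Proof.
move=> fD; apply: cintegrable_windowed_schwartz => //.
exact: bounded_polynomially_bounded fD.
Qed.

Lemma cmeasurable_stft_synthesis : cmeasurable (stft g synthesis).
Proof.
have [D bD] := synthesis_bounded.
by apply: cmeasurable_stft => m; exact: cintegrable_windowed_bounded bD.
Qed.

(** The transform of [f] at [z'] is the sum of [f k * a z' k]. *)
Let a z' k : R[i] := (modul z'.2 (transl z'.1 g) k)^*.

Let ia z' : cintegrable count (a z').
Proof.
have iw := @cintegrable_windowed_bounded (fun=> 1) 1 z'.1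
  (fun=> eq_ind_r (fun x => x <= 1) (lexx 1) (cabs1 R)).
have [_ b] := cintegrable_fourier z'.2 iw; split.
  exact: cmeasurable_lattice.
apply: le_lt_trans b; rewrite le_eqVlt; apply/orP; left; apply/eqP.
apply: eq_integral => k _; rewrite /a cabs_conj /modul /transl /windowed.
by rewrite !cabsM !cabs_conj cabs1 mul1r mulrC.
Qed.

Let iP z' := @cintegrable_lattice_prod _ _ _ _ tf_sigma_finite (a z') W
  (fun k z => time_frequency_shift z h k) C (ia z') iW
  (cmeasurable_time_frequency_shift h)
  (fun k z => eq_ind_r (fun x => x <= C) (hC _) (cabs_time_frequency_shift z h k)).

Let cintegrable_shift z z' :
  cintegrable count (fun k => time_frequency_shift z h k * a z' k).
Proof.
apply: (@cintegrable_count_bound _ _ _ (fun k => cabs (a z' k) * C)) => [k|].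
  rewrite cabsM cabs_time_frequency_shift mulrC.
  by rewrite ler_wpM2l ?cabs_ge0.
exact: integral_cabsMr_lty.
Qed.

Let stft_shiftE z z' : W z * stft g (time_frequency_shift z h) z' =
  cintegral count (fun k => a z' k * (W z * time_frequency_shift z h k)).
Proof.
rewrite -cintegralZl; last exact: cintegrable_shift.
by apply: eq_cintegral => k; rewrite -/(a z' k) mulrA mulrC.
Qed.

Lemma cintegrable_stft_shift z' :
  cintegrable tf (fun z => W z * stft g (time_frequency_shift z h) z').
Proof.
have I0 : (0 <= \int[count]_k (cabs (a z' k) * C)%:E)%E.
  apply: integral_ge0 => k _.
  by rewrite lee_fin mulr_ge0 ?cabs_ge0// (le_trans (cabs_ge0 (h 0))).
pose B := fine (\int[count]_k (cabs (a z' k) * C)%:E).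
apply: (le_cintegrable (h := fun z => cabs (W z) * B)).
- have -> : (fun z => W z * stft g (time_frequency_shift z h) z') =
      (fun z => cintegral count
        (fun k => a z' k * (W z * time_frequency_shift z h k))).
    by apply/funext => z; exact: stft_shiftE.
  exact: cmeasurable_cintegral1 (iP z').
- apply: measurable_funM; last exact: measurable_cst.
  exact: cmeasurable_cabs iW.1.
- move=> z; rewrite cabsM ler_wpM2l ?cabs_ge0// -lee_fin fineK; last first.
    by rewrite ge0_fin_numE//; exact: integral_cabsMr_lty.
  apply: (le_trans (cabs_cintegral_le (cintegrable_shift z z'))).
  apply: ge0_le_integralT => [k|||k].
  + by rewrite lee_fin cabs_ge0.
  + exact: measurable_fun_lattice.
  + exact: measurable_fun_lattice.
  + rewrite lee_fin cabsM cabs_time_frequency_shift mulrC.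
    by rewrite ler_wpM2l ?cabs_ge0.
- exact: integral_cabsMr_lty.
Qed.

(** Fubini's theorem: the transform of a superposition is the superposition of
    the transforms. *)
Lemma stft_synthesis z' :
  stft g synthesis z' =
  cintegral tf (fun z => W z * stft g (time_frequency_shift z h) z').
Proof.
transitivity (cintegral count (fun k => cintegral tf
    (fun z => a z' k * (W z * time_frequency_shift z h k)))).
  apply: eq_cintegral => k; rewrite mulrC -cintegralZl//.
  exact: cintegrable_synthesis.
transitivity (cintegral tf (fun z => cintegral count
    (fun k => a z' k * (W z * time_frequency_shift z h k)))).
  exact: etrans (cintegral12_prod (iP z')) (esym (cintegral21_prod (iP z'))).
by apply: eq_cintegral => z; rewrite stft_shiftE.
Qed.

(** The transform of a superposition of time-frequency shifts of [h] is
    dominated by the convolution of [|W|] with the transform of [h]. *)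
Lemma modulation_norm_synthesis (p : R) : 1 <= p ->
  (modulation_norm g p%:E synthesis <=
   \int[tf]_z (cabs (W z))%:E * modulation_norm g p%:E h)%E.
Proof.
move=> p1; have p0 : 0 < p := lt_le_trans ltr01 p1.
have iw m := cintegrable_windowed_bounded m hC.
pose K (q : (lattice n * torus R n) * (lattice n * torus R n)) :=
  cabs (stft g h (tf_sub q.2 q.1)).
have mV := cmeasurable_cabs (cmeasurable_stft iw).
have mK : measurable_fun setT K by exact: (measurableT_comp mV measurable_tf_sub).
have mW := cmeasurable_cabs iW.1.
pose D := (\int[tf]_z (cabs (stft g h z) `^ p)%:E)%E.
have D0 : (0 <= D)%E.
  by apply: integral_ge0 => z _; rewrite lee_fin powR_ge0.
have A0 : (0 <= \int[tf]_z (cabs (W z))%:E)%E.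
  by apply: integral_ge0 => z _; rewrite lee_fin cabs_ge0.
have KD z : (\int[tf]_z' (K (z, z') `^ p)%:E <= D)%E.
  rewrite le_eqVlt; apply/orP; left; apply/eqP.
  exact: (integral_tf_translation p z iw).
have L := @Lp_superposition _ _ _ tf_sigma_finite tf_sigma_finite p
  (fun z => cabs (W z)) K D p1 mW mK (fun=> cabs_ge0 _) (fun=> cabs_ge0 _)
  iW.2 D0 KD.
have pointwise z' : ((cabs (stft g synthesis z'))%:E <=
    \int[tf]_z (cabs (W z) * K (z, z'))%:E)%E.
  rewrite stft_synthesis.
  apply: (le_trans (cabs_cintegral_le (cintegrable_stft_shift z'))); rewrite le_eqVlt; apply/orP; left.
  apply/eqP; apply: eq_integral => z _.
  by rewrite cabsM cabs_stft_shift.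
have -> : modulation_norm g p%:E h = (D `^ p^-1)%E by exact: modulation_normE.
rewrite modulation_normE.
have -> : (\int[tf]_z (cabs (W z))%:E * D `^ p^-1 =
    ((\int[tf]_z (cabs (W z))%:E) `^ p * D) `^ p^-1)%E.
  by rewrite poweRM ?poweR_ge0// -poweRrM mulfV ?gt_eqF// poweRe1.
have WK0 q : (0 <= (cabs (W q.1) * K q)%:E)%E.
  by rewrite lee_fin mulr_ge0 ?cabs_ge0.
have mWK : measurable_fun setT (fun q : (lattice n * torus R n) * (lattice n * torus R n) =>
    (cabs (W q.1) * K q)%:E).
  apply/measurable_EFinP; apply: measurable_funM; last exact: mK.
  exact: (measurableT_comp mW measurable_fst).
apply: ge0_le_poweR.
- by rewrite invr_ge0 ltW.
- by apply: integral_ge0 => z _; rewrite lee_fin powR_ge0.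
apply: (le_trans _ L); apply: ge0_le_integralT => [z'|||z'].
- by rewrite lee_fin powR_ge0.
- apply/measurable_EFinP; apply: (measurableT_comp (measurable_powR p)).
  exact: cmeasurable_cabs cmeasurable_stft_synthesis.
- apply: (measurableT_comp (measurable_poweR p)).
  exact: (measurable_fun_fubini_tonelli_G (m1 := tf_sigma_finite)
    (fun q : (lattice n * torus R n) * (lattice n * torus R n) =>
    (cabs (W q.1) * K q)%:E) mWK WK0).
- rewrite -poweR_EFin.
  apply: ge0_le_poweR; first exact: ltW.
  + by rewrite lee_fin cabs_ge0.
  + exact: pointwise.
Qed.

End synthesis.

End superposition.

(** * Localization operators *)

Section localization_operator.
Variables (R : realType) (n : nat).
Implicit Types (k m l : lattice n) (w v : torus R n) (f g h : lattice n -> R[i])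
  (z : lattice n * torus R n) (s : lattice n * torus R n -> R[i]).
Local Open Scope classical_set_scope.
Local Notation count := (count_measure R n).
Local Notation tf := (tf_measure R n).

Lemma schwartz_sqsum g : schwartz g -> (sqsum g < +oo)%E.
Proof.
move=> gS; have [C gC] := gS 0%N.
have gC' k : cabs (g k) <= C by have := gC k; rewrite expr0 mul1r.
have ig : cintegrable count g.
  split; first exact: cmeasurable_lattice.
  apply: le_lt_trans (schwartz_summable 0 gS); apply: ge0_le_integralT => [k|||k].
  - by rewrite lee_fin cabs_ge0.
  - exact: measurable_fun_lattice.
  - exact: measurable_fun_lattice.
  - by rewrite expr0 mul1r.
apply: le_lt_trans (integral_cabsMr_lty C ig); apply: ge0_le_integralT => [k|||k].
- by rewrite lee_fin sqr_ge0.
- exact: measurable_fun_lattice.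
- exact: measurable_fun_lattice.
- by rewrite lee_fin expr2 ler_wpM2l ?cabs_ge0.
Qed.

Lemma ell_norm2_gt0 g : (exists k, g k != 0) -> (0 < ell_norm 2%:E g)%E.
Proof.
move=> [k gk0]; rewrite ell_norm2E poweR_gt0//.
apply: (@lt_le_trans _ _ (cabs (g k) ^+ 2)%:E).
  by rewrite lte_fin exprn_gt0// lt_neqAle eq_sym cabs_eq0 gk0 cabs_ge0.
apply: (le_integral_count (h := fun k => (cabs (g k) ^+ 2)%:E)) => j.
by rewrite lee_fin sqr_ge0.
Qed.

Lemma fourier_linear (c : R[i]) (a b : lattice n -> R[i]) w :
  cintegrable count a -> cintegrable count b ->
  fourier (fun k => c * a k + b k) w = c * fourier a w + fourier b w.
Proof.
move=> ia ib; have ica := cintegrable_fourier w ia.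
rewrite /fourier -cintegralZl// -cintegralD; [|exact: cintegrableZl|
  exact: cintegrable_fourier].
by apply: eq_cintegral => k; rewrite mulrDl mulrA.
Qed.

Lemma stft_linear (c : R[i]) g f h z :
  (forall m, cintegrable count (windowed g f m)) ->
  (forall m, cintegrable count (windowed g h m)) ->
  stft g (fun k => c * f k + h k) z = c * stft g f z + stft g h z.
Proof.
move=> iwf iwh; rewrite !stftE -fourier_linear//; congr (fourier _ _).
by apply/funext => k; rewrite /windowed mulrDl mulrA.
Qed.

Definition localization_weight s g1 f z : R[i] := s z * stft g1 f z.

Section weight.
Variables (s : lattice n * torus R n -> R[i]) (g1 f : lattice n -> R[i]).
Hypotheses (is1 : cintegrable tf s) (g1oo : (sqsum g1 < +oo)%E)
  (foo : (sqsum f < +oo)%E).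

Let A : R := fine (ell_norm 2%:E f * ell_norm 2%:E g1)%E.

Let AE : (ell_norm 2%:E f * ell_norm 2%:E g1)%E = A%:E.
Proof. by rewrite fineK// fin_numM// ell_norm2_fin_num. Qed.

Let stftA z : cabs (stft g1 f z) <= A.
Proof. by rewrite -lee_fin -AE; exact: stft_le. Qed.

Let mV : cmeasurable (stft g1 f).
Proof. by apply: cmeasurable_stft => m; exact: cintegrable_windowed_ell2. Qed.

Lemma cintegrable_localization_weight :
  cintegrable tf (localization_weight s g1 f).
Proof. exact: cintegrableMr is1 mV stftA. Qed.

Lemma integral_localization_weight_le :
  (\int[tf]_z (cabs (localization_weight s g1 f z))%:E <=
   cLnorm tf 1%E s * (ell_norm 2%:E f * ell_norm 2%:E g1))%E.
Proof.
have A0 : 0 <= A by exact: le_trans (cabs_ge0 _) (stftA (0, [tuple 0 | i < n])).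
rewrite cLnorm1 AE.
have ms := measurable_cabs_EFin is1.1.
apply: (@le_trans _ _ (\int[tf]_z ((cabs (s z))%:E * A%:E))%E).
  apply: ge0_le_integralT => [z|||z].
  - by rewrite lee_fin cabs_ge0.
  - exact: measurable_cabs_EFin cintegrable_localization_weight.1.
  - by apply: emeasurable_funM; [exact: ms|exact: measurable_cst].
  - by rewrite -EFinM lee_fin cabsM ler_wpM2l ?cabs_ge0.
rewrite le_eqVlt; apply/orP; left; apply/eqP.
apply: ge0_integralZr; [exact: measurableT|exact: ms|
  by move=> z _; rewrite lee_fin cabs_ge0|by rewrite lee_fin].
Qed.

End weight.

(** The iterated integral defining the operator is the integral for the
    product measure. *)
Lemma localizationE s g1 h f (C : R) :
  cintegrable tf (localization_weight s g1 f) -> (forall k, cabs (h k) <= C) ->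
  localization s g1 h f = synthesis h (localization_weight s g1 f).
Proof.
move=> iW hC; apply/funext => k.
have i1 := cintegrable_synthesis iW hC k.
exact: (cintegral12_prod (m1 := count_sigma_finite R n) (m2 := haar R n) i1).
Qed.

Lemma localization_linear s g1 h f1 f2 (c : R[i]) (C : R) :
  (forall k, cabs (h k) <= C) ->
  (forall m, cintegrable count (windowed g1 f1 m)) ->
  (forall m, cintegrable count (windowed g1 f2 m)) ->
  cintegrable tf (localization_weight s g1 f1) ->
  cintegrable tf (localization_weight s g1 f2) ->
  localization s g1 h (fun k => c * f1 k + f2 k) =
  (fun k => c * localization s g1 h f1 k + localization s g1 h f2 k).
Proof.
move=> hC iw1 iw2 iW1 iW2.
have WE : localization_weight s g1 (fun k => c * f1 k + f2 k) =
    (fun z => c * localization_weight s g1 f1 z + localization_weight s g1 f2 z).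
  apply/funext => z; rewrite /localization_weight stft_linear//.
  by rewrite mulrDr mulrCA.
rewrite (localizationE iW1 hC) (localizationE iW2 hC).
rewrite (localizationE _ hC); last first.
  by rewrite WE; apply: cintegrableD => //; exact: cintegrableZl.
apply/funext => k; rewrite WE.
have i1 := cintegrable_synthesis iW1 hC k.
have i2 := cintegrable_synthesis iW2 hC k.
rewrite /synthesis -(cintegralZl c i1) -(cintegralD (cintegrableZl c i1) i2).
by apply: eq_cintegral => z; rewrite mulrDl mulrA.
Qed.

End localization_operator.

Theorem theorem4p13 (R : realType) (n : nat)
    (g : lattice n -> R[i]) (hg : schwartz g) (g_neq0 : exists k, g k != 0)
    (p : R) (hp : 1 <= p <= 2)
    (s : lattice n * torus R n -> R[i])
    (hs : in_Lp (tf_measure R n) 1%E s)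
    (g1 : lattice n -> R[i]) (hg1 : in_ell 2%:E g1)
    (g2 : lattice n -> R[i]) (hg2 : modulation_space g p%:E g2) :
  [/\ forall f, modulation_space g p%:E f -> localization_converges s g1 g2 f,
      bounded_on_modulation g p%:E (localization s g1 g2) &
      (* The window of M^p is normalized; the norm bound is not invariant under
         g |-> c g, and fails for windows with l^2 norm less than 1. *)
      (1 <= ell_norm 2%:E g)%E ->
      (modulation_opnorm g p%:E (localization s g1 g2) <=
         cLnorm (tf_measure R n) 1%E s * ell_norm 2%:E g1 *
         modulation_norm g p%:E g2)%E].
Proof.
have [p1 p2] := andP hp.
have is1 : cintegrable (tf_measure R n) s by apply/in_Lp1P.
have g1oo := in_ell2_sqsum hg1.
have goo := schwartz_sqsum hg.
have [C C1 g2C] := modulation_bounded hg g_neq0 hp hg2.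
have foo f : modulation_space g p%:E f -> (sqsum f < +oo)%E.
  exact: modulation_ell2.
have iW f fM := cintegrable_localization_weight is1 g1oo (foo f fM).
have LE f fM := localizationE (iW f fM) g2C.
have N0 f : (0 <= modulation_norm g p%:E f)%E.
  by rewrite modulation_normE poweR_ge0.
have Nfin f : modulation_space g p%:E f -> modulation_norm g p%:E f \is a fin_num.
  by move=> [_ [_ _ Noo]]; rewrite ge0_fin_numE.
have bound f : modulation_space g p%:E f ->
    (modulation_norm g p%:E (localization s g1 g2 f) <=
     cLnorm (tf_measure R n) 1%E s * (ell_norm 2%:E f * ell_norm 2%:E g1) *
     modulation_norm g p%:E g2)%E.
  move=> fM; rewrite (LE f fM).
  apply: (le_trans (modulation_norm_synthesis hg (iW f fM) g2C p1)).
  apply: lee_wpmul2r; first exact: N0.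
  exact: integral_localization_weight_le is1 g1oo (foo f fM).
pose S := fine (cLnorm (tf_measure R n) 1%E s).
have SE : cLnorm (tf_measure R n) 1%E s = S%:E.
  rewrite fineK// ge0_fin_numE; first by case: hs.
  by rewrite cLnorm1; apply: integral_ge0 => z _; rewrite lee_fin cabs_ge0.
have S0 : 0 <= S.
  rewrite fine_ge0// cLnorm1; apply: integral_ge0 => z _.
  by rewrite lee_fin cabs_ge0.
pose G1 := fine (ell_norm 2%:E g1).
have G1E : ell_norm 2%:E g1 = G1%:E by rewrite fineK// ell_norm2_fin_num.
have G10 : 0 <= G1 by rewrite fine_ge0// ell_norm_ge0.
pose G := fine (ell_norm 2%:E g).
have GE : ell_norm 2%:E g = G%:E by rewrite fineK// ell_norm2_fin_num.
have G0 : 0 < G by rewrite -lte_fin -GE ell_norm2_gt0.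
pose N2 := fine (modulation_norm g p%:E g2).
have N2E : modulation_norm g p%:E g2 = N2%:E by rewrite fineK// Nfin.
have N20 : 0 <= N2 by rewrite fine_ge0.
have fE f : modulation_space g p%:E f ->
    exists F NF : R, [/\ ell_norm 2%:E f = F%:E, modulation_norm g p%:E f = NF%:E,
      0 <= F & F * G <= NF].
  move=> fM; exists (fine (ell_norm 2%:E f)), (fine (modulation_norm g p%:E f)).
  have e1 : ell_norm 2%:E f = (fine (ell_norm 2%:E f))%:E.
    by rewrite fineK// ell_norm2_fin_num// foo.
  have e2 : modulation_norm g p%:E f = (fine (modulation_norm g p%:E f))%:E.
    by rewrite fineK// Nfin.
  split=> //; first by rewrite fine_ge0// ell_norm_ge0.
  rewrite -lee_fin EFinM -e1 -e2 -GE.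
  exact: ell2_le_modulation_norm.
split.
- move=> f fM; split=> [m w|k]; apply/in_Lp1P.
    have := cintegrable_fourier w
      (cintegrable_windowed_ell2 m (foo f fM) g1oo).
    rewrite (_ : (fun k => f k * _) =
      (fun k => windowed g1 f m k * (cis (dot w k))^*))//.
    apply/funext => k; rewrite /modul /transl /windowed conjCM.
    by rewrite mulrA [in RHS]mulrAC.
  exact: (cintegrable_synthesis (iW f fM) g2C k).
- split.
  + move=> f fM; have [F [NF [FE NFE F0 FN]]] := fE f fM.
    have b := bound f fM; rewrite SE FE G1E N2E -!EFinM in b.
    rewrite (LE f fM) in b *; split; first exact: tempered_synthesis (iW f fM) g2C.
    have [mr mi] := cmeasurable_stft_synthesis hg (iW f fM) g2C.
    by split=> //; apply: le_lt_trans b _; exact: ltry.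
  + move=> a f h fM hM.
    have iwf m := cintegrable_windowed_ell2 m (foo f fM) g1oo.
    have iwh m := cintegrable_windowed_ell2 m (foo h hM) g1oo.
    exact: localization_linear g2C iwf iwh (iW f fM) (iW h hM).
  + exists (S * G1 * N2 / G) => f fM; have [F [NF [FE NFE F0 FN]]] := fE f fM.
    apply: (le_trans (bound f fM)); rewrite SE FE G1E N2E NFE -!EFinM lee_fin.
    have -> : S * G1 * N2 / G * NF = S * G1 * N2 * (NF / G) by ring.
    have -> : S * (F * G1) * N2 = S * G1 * N2 * F by ring.
    by rewrite ler_wpM2l ?mulr_ge0// ler_pdivlMr.
move=> gn1; apply: ub_ereal_sup => _ [f [fM f1] <-].
have [F [NF [FE NFE F0 FN]]] := fE f fM.
apply: (le_trans (bound f fM)); rewrite SE FE G1E N2E -!EFinM lee_fin.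
have F1 : F <= 1.
  rewrite NFE lee_fin in f1; rewrite GE lee_fin in gn1.
  by rewrite (le_trans _ f1)// (le_trans _ FN)// ler_peMr.
rewrite ler_wpM2r// ler_wpM2l//.
by rewrite -[leRHS]mul1r ler_wpM2r.
Qed.
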